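(* In the Bayesian $k$-armed bandit problem described in the context, suppose the prior $\Gamma$ is $1$-regular with constants $0<c_0<C_0$, every $P_\mu$ is $1$-subgaussian, and $\mathcal{F}$ is uniformly upward-looking with parameters $(p_0,\delta_0)$. Then for any $k\ge\bigl(4e\log T\max(400,1/\delta_0^2)\bigr)/(c_0p_0)$, $$BR_{T,k}(\mathrm{Greedy})\le1+3T\Bigl[\frac{4e\log T}{kc_0p_0}\Bigr]^{1/2}+\frac{3C_0k}{2C_1}\bigl(10+\log(kc_0p_0/4e)-\log\log T\bigr),$$ where $C_1=(1-e^{-1})/2$. Furthermore, the Bayesian regret of SS-Greedy executed with $m=\Theta(T^{2/3})$ is $\tilde O(T^{2/3})$.
   Context: Bayesian $k$-armed bandit: horizon $T$, arms $[k]$, family $\mathcal{F}=\{P_\mu:\mu\in[0,1]\}$ with $P_\mu$ of mean $\mu$; prior $\Gamma$ on $[0,1]$ with density; means i.i.d. $\sim\Gamma$; pulling arm $i$ at time $t$ gives $Y_{it}\sim P_{\mu_i}$ independently, only the pulled reward observed. $R_T(\pi\mid\bm\mu)=T\max_i\mu_i-\sum_t\mathbb{E}[\mu_{a_t}\mid\pi]$, $BR_{T,k}(\pi)=\mathbb{E}[R_T(\pi\mid\bm\mu)]$. $1$-regular: $c_0\epsilon\le\mathbb{P}_\Gamma(\mu>1-\epsilon)\le\mathbb{P}_\Gamma(\mu\ge1-\epsilon)\le C_0\epsilon$ for $\epsilon\in(0,1]$. $1$-subgaussian: $\mathbb{E}[e^{s(Z-\mu)}]\le e^{s^2/2}$ for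 $Z\sim P_\mu$. A distribution $Q$ of mean $\mu$ with $Q-\mu$ $1$-subgaussian is upward-looking with parameter $p_0$ if, with $X_i$ i.i.d. $\sim Q$, $R_n(\theta)=\sum_{i\le n}X_i-n\theta$, $\tau(\theta)=\inf\{n\ge1:R_n(\theta)<0\text{ or }R_n(\theta)\ge1\}$, for every $\theta<\mu$ either $\mathbb{P}[R_{\tau(\theta)}(\theta)\ge1]\ge p_0$ or $\mathbb{E}[(X_1-\theta)\mathbf 1(X_1\ge\theta)]\ge p_0$. $\mathcal{F}$ is uniformly upward-looking with parameters $(p_0,\delta_0)$ if $P_\mu$ is upward-looking with parameter $p_0$ for every $\mu\ge1-\delta_0$. Greedy: pull each arm once, then always the arm with largest empirical mean. SS-Greedy($m$): run Greedy on $m$ arms drawn uniformly without replacement from $[k]$. $\tilde O$ hides polylog factors and constants. *)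

(* Defs.v *)
From HB Require Import structures.
From mathcomp Require Import all_boot all_order all_algebra.
From mathcomp Require Import all_classical all_reals all_analysis.
From mathcomp Require Import measurable_realfun.
Set Implicit Arguments. Unset Strict Implicit. Unset Printing Implicit Defensive.
Import Order.TTheory GRing.Theory Num.Theory.
Local Open Scope classical_set_scope.
Local Open Scope ring_scope.


Section bandit.
Variable R : realType.

Definition prior_on_unit (Gamma : probability R R) : Prop :=
  Gamma [set` `[0%R, 1%R]] = 1%E.

Definition has_density (Gamma : probability R R) : Prop :=
  exists f : R -> R, measurable_fun setT f /\ (forall x, 0 <= f x) /\
    forall A : set R, measurable A ->
      Gamma A = (\int[@lebesgue_measure R]_(x in A) (f x)%:E)%E.

Definition one_regular (Gamma : probability R R) (c0 C0 : R) : Prop :=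
  forall eps : R, 0 < eps <= 1 ->
    let gt := [set x : R | 1 - eps < x] in
    let ge := [set x : R | 1 - eps <= x] in
    ((c0 * eps)%:E <= Gamma gt)%E /\ (Gamma gt <= Gamma ge)%E /    (Gamma ge <= (C0 * eps)%:E)%E.

Definition family_measurable (P : R -> probability R R) : Prop :=
  forall A : set R, measurable A ->
    measurable_fun ([set` `[0%R, 1%R]] : set R) (fun mu : R => P mu A : \bar R).

Definition has_mean (Q : probability R R) (mu : R) : Prop :=
  Q.-integrable setT (fun x => x%:E) /\ (\int[Q]_x x%:E = mu%:E)%E.

Definition subgaussian1 (Q : probability R R) (mu : R) : Prop :=
  forall s : R, (\int[Q]_x (expR (s * (x - mu)))%:E <= (expR (s ^+ 2 / 2))%:E)%E.

(* Probability that the walk R_n(theta) = sum_{i<=n} X_i - n theta, started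
   at R_0 = 0, exits [0,1) upwards within n steps, i.e.
   P[tau(theta) <= n and R_{tau(theta)}(theta) >= 1];
   [upexit_n Q theta n r] is this probability for the walk started at r. *)
Fixpoint upexit_n (Q : probability R R) (theta : R) (n : nat) (r : R)
    : \bar R :=
  match n with
  | 0%N => 0%E
  | n'.+1 => (\int[Q]_x
       (if (1 <= r + x - theta)%R then 1%E
        else if (0 <= r + x - theta)%R then upexit_n Q theta n' (r + x - theta)
        else 0%E))%E
  end.

(* P[R_{tau(theta)}(theta) >= 1] (event {tau < oo, R_tau >= 1}). *)
Definition upexit (Q : probability R R) (theta : R) : \bar R :=
  ereal_sup (range (fun n => upexit_n Q theta n 0)).

Definition upward_looking (Q : probability R R) (mu p0 : R) : Prop :=
  subgaussian1 Q mu /\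
  forall theta : R, theta < mu ->
    (p0%:E <= upexit Q theta)%E \/
    (p0%:E <= \int[Q]_x (if (theta <= x)%R then (x - theta)%:E else 0%E))%E.

Definition uniformly_upward_looking (P : R -> probability R R)
    (p0 delta0 : R) : Prop :=
  forall mu : R, 1 - delta0 <= mu <= 1 -> upward_looking (P mu) mu p0.

(* State of Greedy: for each arm (in order), (number of pulls, sum of rewards). *)
Definition emp_mean (p : nat * R) : R := p.2 / p.1%:R.

Definition greedy_choice (st : seq (nat * R)) : nat :=
  if has (fun p => p.1 == 0%N) st then find (fun p => p.1 == 0%N) st
  else let M := \big[Num.max/emp_mean (head (0%N, 0) st)]_(p <- st) emp_mean p in
       find (fun p => emp_mean p == M) st.

Definition greedy_update (st : seq (nat * R)) (a : nat) (y : R) :=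
  set_nth (0%N, 0) st a ((nth (0%N, 0) st a).1.+1, (nth (0%N, 0) st a).2 + y).

(* Expected cumulative mean reward sum_{s < t} E[mu_{a_s}] of Greedy over the
   remaining t rounds, from state st, on arms with means mus; the reward of
   a pull of an arm of mean m is drawn from P m independently of the past. *)
Fixpoint greedy_value (P : R -> probability R R) (mus : seq R) (t : nat)
    (st : seq (nat * R)) : \bar R :=
  match t with
  | 0%N => 0%E
  | t'.+1 => let a := greedy_choice st in
      ((nth 0%R mus a)%:E +
       \int[P (nth 0%R mus a)]_y greedy_value P mus t' (greedy_update st a y))%E
  end.

Definition greedy_reward (P : R -> probability R R) (T : nat) (mus : seq R)
    : \bar R := greedy_value P mus T (nseq (size mus) (0%N, 0)).

Definition seqmax (mus : seq R) : R := \big[Num.max/0]_(m <- mus) m.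

Fixpoint prior_expect (Gamma : probability R R) (k : nat)
    (F : seq R -> \bar R) : \bar R :=
  match k with
  | 0%N => F [::]
  | k'.+1 => (\int[Gamma]_x prior_expect Gamma k' (fun s => F (x :: s)))%E
  end.

Definition BR_greedy Gamma P (T k : nat) : \bar R :=
  prior_expect Gamma k
    (fun mus => ((T%:R * seqmax mus)%:E - greedy_reward P T mus)%E).

(* BR_{T,k}(SS-Greedy(m)): Greedy run on a uniformly random m-subset S of
   the k arms (arms of S in increasing index order); regret w.r.t. the best
   of all k arms. *)
Definition BR_ssgreedy Gamma P (T k m : nat) : \bar R :=
  prior_expect Gamma k
    (fun mus => ((T%:R * seqmax mus)%:E -
       (('C(k, m)%:R)^-1)%:E *
       \sum_(S : {set 'I_k} | #|S| == m)
          greedy_reward P T [seq nth 0%R mus (val i) | i <- enum S])%E).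

End bandit.

(* Main.v *)
Require Import Defs.
From HB Require Import structures.
From mathcomp Require Import all_boot all_order all_algebra.
From mathcomp Require Import all_classical all_reals all_analysis.
From mathcomp Require Import measurable_realfun ring lra.

(* Fix [d] with [d ^ 2 = 4 e log T / (m c0 p0)] and [th = 1 - 2 d], and follow
   for each arm the walk (sum of rewards) - (number of pulls) * [th].  As long as
   some arm of mean at least [1 - d] has a nonnegative walk, Greedy only pulls
   arms whose walk is nonnegative: an arm of mean [mu < 1 - 3 d] is then pulled
   on average at most [1 / (1 - expR (- D ^ 2 / 2))] times, where [D = th - mu],
   which costs [O(1 / D)], and any other arm costs at most [3 d] per round.
   Upward-lookingness keeps the walk of an arm of mean at least [1 - d]
   nonnegative forever with probability at least [p0 d / 8], so that all [m] arms
   fail with probability at most [1 / T].  Averaging [1 / D] over the prior gives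
   the logarithm.  The argument is run as a backward induction on an explicit
   potential, so that [greedy_value] itself never has to be measurable. *)

Set Implicit Arguments.
Unset Strict Implicit.
Unset Printing Implicit Defensive.
Import Order.TTheory GRing.Theory Num.Theory.
Local Open Scope classical_set_scope.
Local Open Scope ring_scope.

(** * Integrals of possibly non-measurable functions *)

(** Regret is measured throughout against the value 1, which no mean exceeds, so drawing a subset of
    the arms costs nothing beyond running Greedy on fewer of them. The threshold [th] lies at
    distance at least [d] from the means of good and of bad arms, so that drift pushes the walks of
    the former up and of the latter down. The obstacle is that the choices of Greedy entangle the
    arms. A product of ruin probabilities, each taken at the current walk of its own arm, avoids
    this: a pull moves a single factor, whose mean does not increase, whatever rule selected the
    arm. Horizons count remaining rounds although an arm walks only when pulled; monotonicity of
    [ruin] and [visits] in the horizon covers the rounds in which it rests. *)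

Section lower_integral.
Context d (T : measurableType d) (R : realType).
Import HBNNSimple.
Local Open Scope ereal_scope.

(** Needs no measurability: the integral of a nonnegative function is a supremum over the simple
    functions below it. *)
Lemma ge0_integral_mono (mu : {measure set T -> \bar R}) (f g : T -> \bar R) :
  (forall x, 0 <= f x) -> (forall x, f x <= g x) ->
  \int[mu]_x f x <= \int[mu]_x g x.
Proof.
move=> f0 fg; have g0 x : 0 <= g x by exact: le_trans (fg x).
rewrite !ge0_integralTE//; apply: le_ereal_sup => _ [h /= hf <-].
by exists h => //= x; exact: le_trans (fg x).
Qed.

Lemma integral_prob_cst (Q : probability T R) (c : \bar R) :
  \int[Q]_x (fun=> c) x = c.
Proof. by rewrite integral_cst//= probability_setT mule1. Qed.

(** The negative part of [f] only lowers its integral, and a simple function below the positive part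
    of [f] is almost everywhere below [g]. It serves to restrict the prior to means in the unit
    interval. *)
Lemma integral_le_on (Q : probability T R) (D : set T) (f g : T -> \bar R) :
  measurable D -> Q D = 1 -> measurable_fun setT g -> (forall x, 0 <= g x) ->
  (forall x, D x -> f x <= g x) -> \int[Q]_x f x <= \int[Q]_x g x.
Proof.
move=> mD QD mg g0 fg.
apply: (@le_trans _ _ (\int[Q]_x (f^\+ x))).
  rewrite integralE -[leRHS]sube0; apply: leeB => //.
  by apply: integral_ge0 => x _; exact: funeneg_ge0.
rewrite (ge0_integralTE _ (f := f^\+))//; apply: ge_ereal_sup => _ [h /= hf <-].
rewrite -integralT_nnsfun; apply: ae_ge0_le_integral => //.
- by move=> x _; rewrite lee_fin.
- exact/measurable_EFinP.
- exists (~` D); split; first exact: measurableC.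
    by have := probability_setC Q mD; rewrite QD subee.
  move=> x /= nfg Dx; apply: nfg => _; apply: le_trans (hf x) _.
  by rewrite funeposE ge_max fg//= g0.
Qed.

(* Only [g] is measurable: [f] dominates the measurable function [(c - g)^+]. *)
Lemma cst_le_integralD (Q : probability T R) (c : R) (f g : T -> \bar R) :
  (0 <= c)%R -> (forall x, 0 <= f x) -> measurable_fun setT g ->
  (forall x, 0 <= g x) -> (forall x, c%:E <= f x + g x) ->
  c%:E <= \int[Q]_x f x + \int[Q]_x g x.
Proof.
move=> c0 f0 mg g0 cfg.
pose phi x := maxe 0 (c%:E - g x).
have mphi : measurable_fun setT phi.
  by apply: measurable_maxe => //; apply: emeasurable_funB.
have phi0 x : 0 <= phi x by rewrite /phi le_max lexx.
have phif x : phi x <= f x.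
  rewrite /phi ge_max f0/=.
  case: (g x) (g0 x) (cfg x) => [r||]// _.
    by rewrite leeBlDr.
  by rewrite /= leNye.
apply: (@le_trans _ _ (\int[Q]_x phi x + \int[Q]_x g x)); last first.
  by rewrite leeD2r// ge0_integral_mono.
rewrite -ge0_integralD// -[leLHS](integral_prob_cst Q).
apply: ge0_integral_mono => x; first by rewrite lee_fin.
rewrite /phi; case: (g x) (g0 x) => [r||]//= _.
  rewrite -EFinB -EFin_max -EFinD lee_fin -lerBlDr le_max; apply/orP; right.
  by [].
by rewrite addey ?leey//; case: maxeP.
Qed.

End lower_integral.

Lemma measurable_fun_integral_shift (R : realType) (Q : probability R R)
    (th : R) (F : R -> \bar R) :
  measurable_fun setT F -> (forall x, 0 <= F x)%E ->
  measurable_fun setT (fun r : R => \int[Q]_y F (r + y - th)%R)%E.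
Proof.
move=> mF F0.
apply: (measurable_fun_fubini_tonelli_F (fun p : R * R => F (p.1 + p.2 - th)%R)) => //.
apply: (measurableT_comp mF).
by apply: measurable_funB => //; apply: measurable_funD.
Qed.

(** * Ruin and occupation of the empirical-mean walk *)

Section walk.
Variables (R : realType) (Q : probability R R) (th : R).
Local Open Scope ereal_scope.

(* Probability that the walk with steps [X - th], started at [r], becomes
   negative within [t] steps. *)
Fixpoint ruin (t : nat) (r : R) : \bar R :=
  if (0 <= r)%R then
    if t is t'.+1 then \int[Q]_y ruin t' (r + y - th)%R else 0
  else 1.

(* Expected number of times before [t] at which this walk is nonnegative. *)
Fixpoint visits (t : nat) (r : R) : \bar R :=
  if t is t'.+1 then
    (0 <= r)%R%:R%:E + \int[Q]_y visits t' (r + y - th)%R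
  else 0.

Lemma ruin_ge0 t r : 0 <= ruin t r.
Proof.
elim: t r => [|t IH] r /=; case: ifP => // _.
by apply: integral_ge0 => y _; exact: IH.
Qed.

Lemma visits_ge0 t r : 0 <= visits t r.
Proof.
elim: t r => [//|t IH] r /=; apply: adde_ge0; first by rewrite lee_fin.
by apply: integral_ge0 => y _; exact: IH.
Qed.

Lemma measurable_nonneg : measurable_fun setT (fun r : R => (0 <= r)%R).
Proof. exact: measurable_fun_ler. Qed.

Lemma measurable_ruin t : measurable_fun setT (ruin t).
Proof.
elim: t => [|t IH] /=; apply: measurable_fun_ifT => //;
  try exact: measurable_nonneg.
by apply: measurable_fun_integral_shift => // x; exact: ruin_ge0.
Qed.

Lemma measurable_visits t : measurable_fun setT (visits t).
Proof.
elim: t => [|t IH] /=; first exact: measurable_cst.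
apply: emeasurable_funD.
  apply/measurable_EFinP.
  rewrite (_ : (fun _ => _) =
    (fun r : R => if (0 <= r)%R then 1%R else 0%R : R)).
    by apply: measurable_fun_ifT => //; exact: measurable_nonneg.
  by apply/funext => r; case: ifP.
by apply: measurable_fun_integral_shift => // x; exact: visits_ge0.
Qed.

Lemma measurable_shift (r : R) : measurable_fun setT (fun y : R => (r + y - th)%R).
Proof. by apply: measurable_funB => //; apply: measurable_funD. Qed.

Lemma measurable_ruin_shift t r :
  measurable_fun setT (fun y : R => ruin t (r + y - th)%R).
Proof. exact: measurableT_comp (measurable_ruin t) (measurable_shift r). Qed.

Lemma measurable_visits_shift t r :
  measurable_fun setT (fun y : R => visits t (r + y - th)%R).
Proof. exact: measurableT_comp (measurable_visits t) (measurable_shift r). Qed.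

Lemma ruin_le1 t r : ruin t r <= 1.
Proof.
elim: t r => [|t IH] r /=; case: ifP => // _.
rewrite -[leRHS](integral_prob_cst Q); apply: ge0_integral_mono => y.
  exact: ruin_ge0.
exact: IH.
Qed.

Lemma ruin_step t r : \int[Q]_y ruin t (r + y - th)%R <= ruin t.+1 r.
Proof.
rewrite /=; case: ifP => // _.
rewrite -[leRHS](integral_prob_cst Q); apply: ge0_integral_mono => y.
  exact: ruin_ge0.
exact: ruin_le1.
Qed.

Lemma ruin_mono t r : ruin t r <= ruin t.+1 r.
Proof.
elim: t r => [|t IH] r.
  rewrite /=; case: ifP => // _; apply: integral_ge0 => y _.
  by case: ifP.
rewrite [leLHS]/= [leRHS]/=; case: ifP => // _.
by apply: ge0_integral_mono => y; [exact: ruin_ge0|exact: IH].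
Qed.

Lemma visits_mono t r : visits t r <= visits t.+1 r.
Proof.
elim: t r => [|t IH] r; first exact: visits_ge0.
rewrite [leLHS]/= [leRHS]/= leeD2l//.
by apply: ge0_integral_mono => y; [exact: visits_ge0|exact: IH].
Qed.

Variable mu : R.
Hypothesis sgQ : subgaussian1 Q mu.

Lemma measurable_exp_affine (c s : R) :
  measurable_fun setT (fun y : R => (expR (c + s * (y - th)))%:E).
Proof.
apply/measurable_EFinP; apply: measurableT_comp => //.
by apply: measurable_funD => //; apply: measurable_funM => //; apply: measurable_funB.
Qed.

Lemma exp_moment_le (c s : R) :
  \int[Q]_y (expR (c + s * (y - th)))%:E <=
    (expR (c + s * (mu - th) + s ^+ 2 / 2))%:E.
Proof.
have -> : (fun y => (expR (c + s * (y - th)))%:E) =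
    (fun y => (expR (c + s * (mu - th)))%:E * (expR (s * (y - mu)))%:E).
  by apply/funext => y; rewrite -EFinM -expRD; congr (expR _)%:E; ring.
rewrite ge0_integralZl_EFin ?expR_ge0//; last first.
  apply/measurable_EFinP; apply: measurableT_comp => //.
  by apply: measurable_funM => //; apply: measurable_funB.
rewrite [in leRHS]expRD EFinM; apply: lee_wpmul2l; last exact: sgQ.
by rewrite lee_fin expR_ge0.
Qed.

(** Along the walk [expR (- l * r)] is a supermartingale: subgaussianity bounds the mean factor of a
    step by [expR (- l * (mu - th) + l ^ 2 / 2)], which is at most 1 as [l <= 2 * (mu - th)]. On
    negative positions it is at least 1. *)
Lemma ruin_le_exp l t r : (0 <= l)%R -> (l <= 2 * (mu - th))%R ->
  ruin t r <= (expR (- l * r))%:E.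
Proof.
move=> l0 lxi.
have big x : (x < 0)%R -> 1 <= (expR (- l * x))%:E.
  move=> x0; rewrite lee_fin -expR0 ler_expR mulNr -mulrN.
  by rewrite mulr_ge0// oppr_ge0 ltW.
elim: t r => [|t IH] r /=; case: (leP 0%R r) => // r0.
- exact: big.
- apply: (@le_trans _ _ (\int[Q]_y (expR (- l * r + (- l) * (y - th)))%:E)).
    apply: ge0_integral_mono => y; first exact: ruin_ge0.
    by apply: le_trans (IH _) _; rewrite lee_fin ler_expR; lra.
  apply: le_trans (exp_moment_le _ _) _; rewrite lee_fin ler_expR.
  by rewrite -addrA gerDl; nra.
- exact: big.
Qed.

(** The function [expR (D * r)] dominates the indicator of [0 <= r], and a step shrinks its mean at
    least by the factor [rho], because [- D ^ 2 + D ^ 2 / 2 = - D ^ 2 / 2]. The bound is the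
    resulting geometric series. *)
Lemma visits_le_exp t r : (mu < th)%R ->
  visits t r <=
    (expR ((th - mu) * r) / (1 - expR (- ((th - mu) ^+ 2 / 2))))%:E.
Proof.
move=> muth; set D := (th - mu)%R; set rho := expR (- _).
have D0 : (0 < D)%R by rewrite subr_gt0.
have rho1 : (0 < 1 - rho)%R.
  by rewrite subr_gt0 expR_lt1 oppr_lt0 divr_gt0// exprn_gt0.
elim: t r => [|t IH] r; first by rewrite lee_fin divr_ge0 ?expR_ge0// ltW.
rewrite [visits _ _]/=.
apply: (@le_trans _ _ ((expR (D * r))%:E + (expR (D * r) * rho / (1 - rho))%:E)).
  apply: leeD.
    rewrite lee_fin; case: (leP 0%R r) => [r0|_]; last exact: expR_ge0.
    by rewrite -expR0 ler_expR mulr_ge0// ltW.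
  apply: (@le_trans _ _ (\int[Q]_y ((1 - rho)^-1%:E * (expR (D * r + D * (y - th)))%:E))).
    apply: ge0_integral_mono => y; first exact: visits_ge0.
    apply: le_trans (IH _) _; rewrite -EFinM lee_fin mulrC ler_wpM2l//.
      by rewrite invr_ge0 ltW.
    by rewrite ler_expR; lra.
  rewrite ge0_integralZl_EFin//; last 2 first.
  - exact: measurable_exp_affine.
  - by rewrite invr_ge0 ltW.
  rewrite [leRHS](_ : _ = (1 - rho)^-1%:E * (expR (D * r) * rho)%:E); last first.
    by rewrite -EFinM mulrC.
  apply: lee_wpmul2l; first by rewrite lee_fin invr_ge0 ltW.
  apply: le_trans (exp_moment_le _ _) _; rewrite lee_fin /rho -expRD ler_expR.
  by rewrite /D; nra.
rewrite -EFinD lee_fin le_eqVlt; apply/orP; left; apply/eqP; field.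
by rewrite gt_eqF.
Qed.

End walk.

(** * Elementary inequalities for the exponential *)

Section exp_bounds.
Variable R : realType.
Implicit Types u x : R.

Lemma expR_ge_quad u : 0 <= u -> 1 + u + u ^+ 2 / 2 <= expR u.
Proof.
move=> u0.
have -> : 1 + u + u ^+ 2 / 2 = series (exp_coeff u) 3.
  rewrite /series /exp_coeff /= !big_nat_recr//= big_geq//.
  by rewrite !expr0 !fact0 expr1 /= add0r divr1 divr1.
apply: nondecreasing_cvgn_le; last exact: is_cvg_series_exp_coeff.
apply: nondecreasing_series => n _ _ /=.
by rewrite /exp_coeff /= divr_ge0// exprn_ge0.
Qed.

Lemma expRN_le_quad u : 0 <= u -> expR (- u) <= 1 - u + u ^+ 2 / 2.
Proof.
move=> u0; rewrite expRN.
have e0 : 0 < expR u := expR_gt0 u.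
have q0 : 0 <= 1 - u + u ^+ 2 / 2 by nra.
rewrite -[leLHS]mul1r ler_pdivrMr//.
apply: (@le_trans _ _ ((1 - u + u ^+ 2 / 2) * (1 + u + u ^+ 2 / 2))).
  have -> : (1 - u + u ^+ 2 / 2) * (1 + u + u ^+ 2 / 2) = 1 + (u ^+ 2 / 2) ^+ 2.
    by field.
  by rewrite lerDl sqr_ge0.
by rewrite ler_wpM2l// expR_ge_quad.
Qed.

(** For [u = x / 2 >= 0], the right side minus 2 is the square of [expR u - expR (- u)], which is at
    least [2 * u]. This bounds a second moment by the exponential moments at 1 and -1, hence by
    [subgaussian1]. *)
Lemma sqr_le_expRDN x : x ^+ 2 + 2 <= expR x + expR (- x).
Proof.
wlog x0 : x / 0 <= x.
  move=> h; have [/h//|/ltW xN] := leP 0 x.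
  by have := h (- x); rewrite oppr_ge0 sqrrN opprK addrC (addrC (expR _)) addrC;
    apply.
pose u := x / 2.
have u0 : 0 <= u by rewrite divr_ge0.
have xu : x = u + u by rewrite /u; field.
have h1 := expR_ge_quad u0; have h2 := expRN_le_quad u0.
have eu : expR u * expR (- u) = 1 by rewrite expRxMexpNx_1.
rewrite xu opprD !expRD.
have d2 : 0 <= expR u - expR (- u) - 2 * u by lra.
have : 0 <= (expR u - expR (- u) - 2 * u) * (expR u - expR (- u) + 2 * u).
  by rewrite mulr_ge0//; lra.
by rewrite -subr_sqr; nra.
Qed.

Lemma expR_half_le : expR (2^-1 : R) <= 16 / 9.
Proof.
have h : 3 / 4 <= expR (- 4^-1 : R).
  by apply: le_trans (expR_ge1Dx _); lra.
have e : expR (2^-1 : R) * (expR (- 4^-1) * expR (- 4^-1)) = 1.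
  by rewrite -!expRD -expR0; congr expR; field.
have e0 := expR_gt0 (2^-1 : R).
have h2 : 9 / 16 <= expR (- 4^-1 : R) * expR (- 4^-1) by nra.
by nra.
Qed.

End exp_bounds.

(** * Survival of upward-looking arms *)

Section upward_survival.
Variables (R : realType) (Q : probability R R) (mu p0 th : R).
Local Open Scope ereal_scope.

Lemma upexit_n_ge0 n r : 0 <= upexit_n Q th n r.
Proof.
elim: n r => [//|n IH] r /=; apply: integral_ge0 => x _.
by case: ifP => // _; case: ifP.
Qed.

Definition upexit_next n (z : R) : \bar R :=
  if (1 <= z)%R then 1 else if (0 <= z)%R then upexit_n Q th n z else 0.

Lemma upexit_next_ge0 n z : 0 <= upexit_next n z.
Proof. by rewrite /upexit_next; do 2!case: ifP => // _; exact: upexit_n_ge0. Qed.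

Lemma upexit_nS n r :
  upexit_n Q th n.+1 r = \int[Q]_x upexit_next n (r + x - th)%R.
Proof. by []. Qed.

Lemma measurable_upexit_next n : measurable_fun setT (upexit_next n).
Proof.
have step m : measurable_fun setT (upexit_n Q th m) ->
    measurable_fun setT (upexit_next m).
  move=> mm; apply: measurable_fun_ifT => //; first exact: measurable_fun_ler.
  by apply: measurable_fun_ifT => //; exact: measurable_nonneg.
apply: (step n); elim: n => [|n IH]; first exact: measurable_cst.
apply: (@measurable_fun_integral_shift R Q th (upexit_next n)); first exact: step.
exact: upexit_next_ge0.
Qed.

Lemma upexit_n_le1 n r : upexit_n Q th n r <= 1.
Proof.
elim: n r => [|n IH] r; first exact: lee01.
rewrite upexit_nS -[leRHS](integral_prob_cst Q).
apply: ge0_integral_mono => x; first exact: upexit_next_ge0.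
by rewrite /upexit_next; do 2!case: ifP => // _.
Qed.

Hypothesis sgQ : subgaussian1 Q mu.

(* Once the walk has exceeded 1 it is ruined with probability at most
   [expR (- l)], by [ruin_le_exp]. *)
Lemma ruinD_upexit_n_le1 l t n r :
  (0 <= l)%R -> (l <= 2 * (mu - th))%R -> (0 <= r)%R ->
  ruin Q th t r + (1 - expR (- l))%:E * upexit_n Q th n r <= 1.
Proof.
move=> l0 lxi; have c0 : (0 <= 1 - expR (- l))%R.
  by rewrite subr_ge0 expR_le1 oppr_le0.
elim: t n r => [|t IH] [|n] r r0.
- by rewrite /= r0 mule0 add0e.
- rewrite [ruin _ _ _ _]/= r0 add0e.
  apply: (@le_trans _ _ ((1 - expR (- l))%:E * 1)).
    by apply: lee_wpmul2l => //; exact: upexit_n_le1.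
  by rewrite mule1 lee_fin gerBl expR_ge0.
- by rewrite [upexit_n _ _ _ _]/= mule0 adde0 ruin_le1.
rewrite upexit_nS [ruin _ _ _ _]/= r0.
have mup : measurable_fun setT (fun x : R => upexit_next n (r + x - th)%R).
  exact: measurableT_comp (measurable_upexit_next n) (measurable_shift _ _).
rewrite -ge0_integralZl_EFin//; last by move=> x _; exact: upexit_next_ge0.
rewrite -ge0_integralD//; last 4 first.
- by move=> x _; exact: ruin_ge0.
- exact: measurable_ruin_shift.
- by move=> x _; rewrite mule_ge0// upexit_next_ge0.
- exact: measurable_funeM.
rewrite -[leRHS](integral_prob_cst Q); apply: ge0_integral_mono => x.
  by rewrite adde_ge0 ?ruin_ge0// mule_ge0// upexit_next_ge0.
rewrite /upexit_next; case: ifPn => [x1|_].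
  rewrite mule1; apply: (@le_trans _ _ ((expR (- l))%:E + (1 - expR (- l))%:E)).
    rewrite leeD2r//; apply: le_trans (ruin_le_exp sgQ _ _ l0 lxi) _.
    by rewrite lee_fin ler_expR; nra.
  by rewrite -EFinD lee_fin addrC subrK.
by case: ifPn => [x0|_]; [exact: IH|rewrite mule0 adde0 ruin_le1].
Qed.

Definition excess (x : R) : \bar R := if (th <= x)%R then (x - th)%:E else 0.

Lemma excess_ge0 x : 0 <= excess x.
Proof. by rewrite /excess; case: ifP => // h; rewrite lee_fin subr_ge0. Qed.

Lemma measurable_excess : measurable_fun setT excess.
Proof.
apply: measurable_fun_ifT => //; first exact: measurable_fun_ler.
by apply/measurable_EFinP; exact: measurable_funB.
Qed.

(** The bound [x - th <= excess x] is integrated with [th] moved to the right, where [0 <= th] keeps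
    the dominating function nonnegative. *)
Lemma mean_le_excess : has_mean Q mu -> (0 <= th)%R ->
  (mu - th)%:E <= \int[Q]_x excess x.
Proof.
move=> [_ Qmu] th0; rewrite EFinB leeBlDr// -Qmu.
have -> : \int[Q]_x excess x + th%:E = \int[Q]_x (excess x + (cst th%:E) x).
  rewrite ge0_integralD//; first by rewrite integral_prob_cst.
  - by move=> x _; exact: excess_ge0.
  - exact: measurable_excess.
apply: (@integral_le_on _ _ _ Q setT) => //.
- exact: probability_setT.
- by apply: emeasurable_funD => //; exact: measurable_excess.
- by move=> x; rewrite adde_ge0 ?excess_ge0.
move=> x _; rewrite /excess /=; case: (leP th x) => [_|/ltW xth].
  by rewrite -EFinD subrK.
by rewrite add0e lee_fin.
Qed.

(** The first step lands at [y - th]. Above the threshold, [ruin_le_exp] and the quadratic bound on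
    the exponential gain the linear term [l * excess y]; below it, ruin is bounded by 1. The error
    is a second moment, controlled through [sqr_le_expRDN]. *)
Lemma ruin0_le_excess l t w : (0 <= l)%R -> (l <= 2 * (mu - th))%R ->
  (0 <= th <= mu)%R -> w%:E <= \int[Q]_x excess x ->
  \int[Q]_y ruin Q th t (0 + y - th)%R <=
    (1 - l * w + l ^+ 2 * ((mu - th) ^+ 2 + 2 * expR (2^-1) - 2))%:E.
Proof.
move=> l0 lxi /andP[th0 thmu] wx; set xi := (mu - th)%R in lxi *.
have mexp s : measurable_fun setT (fun y : R => (expR (s * (y - mu)))%:E).
  have := measurable_exp_affine mu 0 s.
  by under eq_fun do rewrite add0r.
have mr := measurable_ruin_shift Q th t 0; have mx := measurable_excess.
(* Terms with a minus sign are moved across, so that both integrands are nonnegative. *)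
have key : \int[Q]_y (ruin Q th t (0 + y - th)%R + l%:E * excess y
        + (cst (2 * l ^+ 2)%:E) y) <=
    \int[Q]_y ((cst (1 + l ^+ 2 * xi ^+ 2)%:E) y + (l ^+ 2)%:E *
        ((expR (1 * (y - mu)))%:E + (expR ((-1) * (y - mu)))%:E)).
  apply: ge0_integral_mono => y.
    rewrite !adde_ge0 ?ruin_ge0//; last by rewrite lee_fin mulr_ge0// sqr_ge0.
    by rewrite mule_ge0// excess_ge0.
  rewrite /excess /= mul1r mulN1r -?EFinD -?EFinM -?EFinD.
  have hc := sqr_le_expRDN (y - mu).
  case: (leP th y) => [thy|ythy].
    have yth0 : (0 <= y - th)%R by rewrite subr_ge0.
    apply: (@le_trans _ _ ((expR (- (l * (y - th))))%:E + (l * (y - th))%:E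
        + (2 * l ^+ 2)%:E)).
      rewrite -EFinM !leeD2r//; apply: le_trans (ruin_le_exp sgQ _ _ l0 lxi) _.
      by rewrite add0r mulNr.
    have := expRN_le_quad (mulr_ge0 l0 yth0).
    rewrite -!EFinD lee_fin => he.
    have hz : ((y - th) ^+ 2 / 2 <= (y - mu) ^+ 2 + xi ^+ 2)%R.
      by rewrite /xi; have := sqr_ge0 ((y - mu) - (mu - th))%R; nra.
    have l2 : (0 <= l ^+ 2)%R by exact: sqr_ge0.
    have : (l ^+ 2 * ((y - th) ^+ 2 / 2) <= l ^+ 2 *
      (expR (y - mu) + expR (- (y - mu)) - 2 + xi ^+ 2))%R.
      by rewrite ler_wpM2l//; lra.
    move: he; rewrite exprMn; lra.
  rewrite mule0 adde0; apply: (@le_trans _ _ (1 + (2 * l ^+ 2)%:E)).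
    by rewrite leeD2r// ruin_le1.
  rewrite -EFinD lee_fin; have l2 : (0 <= l ^+ 2)%R by exact: sqr_ge0.
  have : (l ^+ 2 * 2 <= l ^+ 2 * (expR (y - mu) + expR (- (y - mu))))%R.
    by rewrite ler_wpM2l//; have := sqr_ge0 (y - mu); lra.
  have : (0 <= l ^+ 2 * xi ^+ 2)%R by rewrite mulr_ge0// sqr_ge0.
  lra.
have l20 : (0 <= l ^+ 2)%R by exact: sqr_ge0.
move: key; rewrite ge0_integralD//; last 3 first.
- by move=> y _; rewrite adde_ge0 ?ruin_ge0// mule_ge0// excess_ge0.
- by apply: emeasurable_funD => //; exact: measurable_funeM.
- by move=> y _; rewrite lee_fin mulr_ge0.
rewrite ge0_integralD//; last 3 first.
- by move=> y _; exact: ruin_ge0.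
- by move=> y _; rewrite mule_ge0// excess_ge0.
- exact: measurable_funeM.
rewrite ge0_integralZl_EFin//; last by move=> y _; exact: excess_ge0.
rewrite [leRHS]ge0_integralD//; last 3 first.
- by move=> y _; rewrite lee_fin addr_ge0// mulr_ge0// sqr_ge0.
- by move=> y _; rewrite mule_ge0// adde_ge0.
- by apply: measurable_funeM; exact: emeasurable_funD.
rewrite ge0_integralZl_EFin//; last 2 first.
- by move=> y _; rewrite adde_ge0.
- exact: emeasurable_funD.
rewrite ge0_integralD// !integral_prob_cst.
set I := \int[Q]_y ruin Q th t (0 + y - th)%R; set J := \int[Q]_x excess x in wx *.
set E1 := \int[Q]_x (expR (1 * (x - mu)))%:E.
set E2 := \int[Q]_x (expR ((-1) * (x - mu)))%:E.
have e1 : E1 <= (expR 2^-1)%:E.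
  by apply: le_trans (sgQ _) _; rewrite lee_fin ler_expR expr1n mul1r.
have e2 : E2 <= (expR 2^-1)%:E.
  by apply: le_trans (sgQ _) _; rewrite lee_fin ler_expR sqrrN expr1n mul1r.
move=> key.
have : I + l%:E * w%:E + (2 * l ^+ 2)%:E <=
    (1 + l ^+ 2 * xi ^+ 2)%:E + (l ^+ 2)%:E * ((expR 2^-1)%:E + (expR 2^-1)%:E).
  apply: le_trans (le_trans key _).
    by rewrite leeD2r// leeD2l// lee_wpmul2l.
  by rewrite leeD2l// lee_wpmul2l// leeD.
have I0 : 0 <= I by apply: integral_ge0 => y _; exact: ruin_ge0.
clear key wx e1 e2; case: I I0 => [i||]// _.
by rewrite -?EFinM -?EFinD -?EFinM -?EFinD !lee_fin; lra.
Qed.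

Hypothesis upQ : upward_looking Q mu p0.

Lemma ruin0_upward t : has_mean Q mu -> (0 <= p0)%R -> (0 <= th < mu)%R ->
  (mu - th <= 10^-1)%R ->
  ruin Q th t 0%R <= (1 - p0 * (mu - th) / 8)%:E.
Proof.
move=> Qmu p00 /andP[th0 thmu] xi1.
set xi := (mu - th)%R in xi1 *.
have xi0 : (0 < xi)%R by rewrite subr_gt0.
have lxi c : (c <= 2)%R -> (c * xi <= 2 * (mu - th))%R.
  by move=> c2; rewrite ler_wpM2r// ltW.
have [_ /(_ th thmu)[up|ex]] := upQ.
  (* Here [1 - expR (- l) >= l - l ^ 2 / 2 >= xi / 4], so this case even gives survival
     [p0 * xi / 4]. *)
  pose l := (2^-1 * xi)%R.
  have l0 : (0 <= l)%R by rewrite mulr_ge0// ltW.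
  have ll : (l <= 2 * (mu - th))%R by apply: lxi; lra.
  have c0 : (4^-1 * xi <= 1 - expR (- l))%R.
    by have := expRN_le_quad l0; rewrite /l; nra.
  have c1 : (0 < 1 - expR (- l))%R by apply: lt_le_trans c0; rewrite mulr_gt0.
  have : ruin Q th t 0%R \is a fin_num.
    by rewrite ge0_fin_numE ?ruin_ge0// (le_lt_trans (ruin_le1 _ _ _ _))// ltry.
  case E : (ruin Q th t 0%R) => [a||]// _.
  have : p0%:E <= ((1 - a) / (1 - expR (- l)))%:E.
    apply: le_trans up _; apply: ge_ereal_sup => _ [n _ <-].
    have := ruinD_upexit_n_le1 t n l0 ll (lexx 0%R).
    rewrite E; have := upexit_n_ge0 n 0%R.
    case: (upexit_n _ _ _ _) => [u||]//.
      by rewrite -EFinM -EFinD !lee_fin ler_pdivlMr// => _; lra.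
    by move=> _; rewrite gt0_muley.
  rewrite !lee_fin ler_pdivlMr// => h.
  have : (p0 * (4^-1 * xi) <= p0 * (1 - expR (- l)))%R by rewrite ler_wpM2l.
  have := mulr_ge0 p00 (ltW xi0); lra.
(* When [p0] is small compared with [xi], it cannot absorb the error of order [l ^ 2]. The gap [xi]
   is also a lower bound for the mean excess, so the maximum may be used. *)
pose w := Num.max xi p0.
have ww : w%:E <= \int[Q]_x excess x.
  by rewrite /w /Num.max; case: ifP => // _; exact: mean_le_excess.
(* The bound becomes [1 - xi * w / 4 + 1.58 * xi ^ 2 / 16]; as [xi <= w], a gain of more than
   [xi * w / 8] remains, whence the 8 of the statement. *)
pose l := (4^-1 * xi)%R.
have l0 : (0 <= l)%R by rewrite mulr_ge0// ltW.
have ll : (l <= 2 * (mu - th))%R by apply: lxi; lra.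
apply: le_trans (ruin_mono _ _ _ _) _.
rewrite [ruin _ _ _ _]/= lexx.
have thm : (0 <= th <= mu)%R by rewrite th0 ltW.
apply: le_trans (ruin0_le_excess _ l0 ll thm ww) _.
rewrite lee_fin -/xi /l.
have := expR_half_le R => eh.
have xiw : (xi <= w)%R by rewrite /w le_max lexx.
have pw : (p0 <= w)%R by rewrite /w le_max lexx orbT.
have b : (xi ^+ 2 + 2 * expR 2^-1 - 2 <= 158 / 100)%R by nra.
have b2 : ((4^-1 * xi) ^+ 2 * (xi ^+ 2 + 2 * expR 2^-1 - 2) <=
   (4^-1 * xi) ^+ 2 * (158 / 100))%R by rewrite ler_wpM2l// sqr_ge0.
have b3 : (xi * xi <= xi * w)%R by rewrite ler_wpM2l// ltW.
have b4 : (p0 * xi <= xi * w)%R by rewrite mulrC ler_wpM2l// ltW.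
have b5 : (0 <= xi * w)%R by rewrite mulr_ge0 ?ltW// (lt_le_trans xi0).
by move: b2; nra.
Qed.

End upward_survival.

Lemma lee_prod (R : realDomainType) (I : Type) (s : seq I) (A : pred I)
    (f g : I -> \bar R) : (forall i, A i -> 0 <= f i <= g i)%E ->
  (\prod_(i <- s | A i) f i <= \prod_(i <- s | A i) g i)%E.
Proof.
move=> fg; suff /andP[] : (0 <= \prod_(i <- s | A i) f i <=
    \prod_(i <- s | A i) g i)%E by [].
elim/big_rec2: _ => [|i x y Ai /andP[y0 yx]]; first by rewrite lexx lee01.
by have /andP[f0 fgi] := fg i Ai; rewrite mule_ge0//= lee_pmul.
Qed.

(** * Greedy and its potential *)

Section greedy_choice.
Variable R : realType.
Implicit Type st : seq (nat * R).

Lemma bigmax_in (T : Type) (f : T -> R) (x : R) (s : seq T) :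
  \big[Num.max/x]_(p <- s) f p \in x :: map f s.
Proof.
elim: s => [|p s IH]; first by rewrite big_nil mem_head.
rewrite big_cons; case: (leP (f p) _) => _; last by rewrite !inE eqxx orbT.
by move: IH; rewrite !inE => /orP[->//|->]; rewrite !orbT.
Qed.

Lemma le_bigmax_nth (T : Type) (f : T -> R) (x : R) (s : seq T) p0 i :
  (i < size s)%N -> f (nth p0 s i) <= \big[Num.max/x]_(p <- s) f p.
Proof.
elim: s i => [//|p s IH] [|i] /= ilt; rewrite big_cons le_max ?lexx//.
by rewrite IH ?orbT.
Qed.

Variant greedy_choice_spec st : nat -> Prop :=
| GreedyUnpulled a of (a < size st)%N & (nth (0%N, 0) st a).1 = 0%N :
    greedy_choice_spec st a
| GreedyLargest a of (a < size st)%N &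
    (forall i, (i < size st)%N -> (nth (0%N, 0) st i).1 != 0%N) &
    (forall i, (i < size st)%N ->
      emp_mean (nth (0%N, 0) st i) <= emp_mean (nth (0%N, 0) st a)) :
    greedy_choice_spec st a.

Lemma greedy_choiceP st : (0 < size st)%N ->
  greedy_choice_spec st (greedy_choice st).
Proof.
move=> st0; rewrite /greedy_choice; case: ifPn => [h|/hasPn h].
  by apply: GreedyUnpulled; [rewrite -has_find|exact/eqP/(nth_find (0%N, 0) h)].
set M := \big[_/_]_(p <- _) _.
have hM : has (fun p => emp_mean p == M) st.
  have : M \in [seq emp_mean p | p <- st].
    have := bigmax_in (@emp_mean R) (emp_mean (head (0%N, 0) st)) st.
    rewrite -/M inE => /orP[/eqP ->|//].
    by case: (st) st0 => // p s _; rewrite mem_head.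
  by move=> /mapP[p pst Mp]; apply/hasP; exists p => //; rewrite Mp.
apply: GreedyLargest; first by rewrite -has_find.
  by move=> i ilt; apply: h; exact: mem_nth.
move=> i ilt; rewrite (eqP (nth_find (0%N, 0) hM)).
exact: le_bigmax_nth.
Qed.

(** Puts the walk of an unpulled arm at 0, so that forced initial pulls also go to nonnegative
    walks. *)
Definition wf_state st := forall i,
  (nth (0%N, 0) st i).1 = 0%N -> (nth (0%N, 0) st i).2 = 0.

(* The position of the walk [R_n (th)] of arm [i]. *)
Definition walk_pos (th : R) st i : R :=
  (nth (0%N, 0) st i).2 - (nth (0%N, 0) st i).1%:R * th.

Lemma greedy_choice_lt st : (0 < size st)%N -> (greedy_choice st < size st)%N.
Proof. by case/greedy_choiceP. Qed.

(** For a pulled arm, a nonnegative walk means an empirical mean at least [th], a property that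
    passes to the largest empirical mean. An unpulled arm sits at 0. *)
Lemma walk_pos_greedy_choice th st i : wf_state st -> (i < size st)%N ->
  0 <= walk_pos th st i -> 0 <= walk_pos th st (greedy_choice st).
Proof.
move=> wf ilt; rewrite /walk_pos.
case: (greedy_choiceP (leq_ltn_trans (leq0n i) ilt)) => a alt.
  by move=> a0 _; rewrite (wf _ a0) a0 mul0r subr0.
move=> n0 /(_ i ilt); rewrite /emp_mean !subr_ge0 => le_ia thi.
have pos j : (j < size st)%N -> 0 < (nth (0%N, 0) st j).1%:R :> R.
  by move=> jlt; rewrite ltr0n lt0n n0.
rewrite mulrC -ler_pdivlMr ?pos//; apply: le_trans le_ia.
by rewrite ler_pdivlMr ?pos// mulrC.
Qed.

Lemma size_greedy_update st a y : (a < size st)%N ->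
  size (greedy_update st a y) = size st.
Proof. by move=> alt; rewrite size_set_nth; apply/maxn_idPr. Qed.

Lemma wf_greedy_update st a y : wf_state st -> wf_state (greedy_update st a y).
Proof.
move=> wf i; rewrite /greedy_update nth_set_nth /=.
by case: eqP => // _; exact: wf.
Qed.

Lemma walk_pos_greedy_update th st a y i :
  walk_pos th (greedy_update st a y) i =
  if i == a then walk_pos th st a + y - th else walk_pos th st i.
Proof.
rewrite /walk_pos /greedy_update nth_set_nth /=; case: eqP => // _ /=.
by rewrite -natr1; ring.
Qed.

End greedy_choice.

Section potential.
Variables (R : realType) (P : R -> probability R R) (mus : seq R) (d : R).
Hypothesis mus01 : forall i, 0 <= nth 0 mus i <= 1.
Hypothesis d0 : 0 <= d.
Local Open Scope ereal_scope.

Local Notation th := (1 - 2 * d)%R.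
Local Notation arm i := (nth 0%R mus i).
Local Notation k := (size mus).

Definition fail_factor t i (r : R) : \bar R :=
  if (1 - d <= arm i)%R then ruin (P (arm i)) th t r else 1.

(** Regret of one pull against the value 1, set to 0 when the [3 * d] per round of [potential]
    already pays for it. *)
Definition arm_weight i : R := if (arm i < 1 - 3 * d)%R then (1 - arm i)%R else 0%R.

Definition arm_cost t i (r : R) : \bar R :=
  (arm_weight i)%:E * visits (P (arm i)) th t r.

(* Bounds the regret of the remaining [t] rounds: the first term accounts for
   all good arms (means at least [1 - d]) eventually falling below [th], the
   last one for the pulls of bad arms while their empirical mean exceeds [th]. *)
Definition potential t (st : seq (nat * R)) : \bar R :=
  t%:R%:E * \prod_(i < k) fail_factor t i (walk_pos th st i) +
  (t%:R * (3 * d))%:E + \sum_(i < k) arm_cost t i (walk_pos th st i).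

Lemma fail_factor_ge0 t i r : 0 <= fail_factor t i r.
Proof. by rewrite /fail_factor; case: ifP => // _; exact: ruin_ge0. Qed.

Lemma arm_weight_ge0 i : (0 <= arm_weight i)%R.
Proof.
rewrite /arm_weight; case: ifP => // _.
by rewrite subr_ge0; have /andP[] := mus01 i.
Qed.

Lemma arm_cost_ge0 t i r : 0 <= arm_cost t i r.
Proof. by rewrite mule_ge0 ?visits_ge0// lee_fin arm_weight_ge0. Qed.

Lemma fail_factor_mono t i r : fail_factor t i r <= fail_factor t.+1 i r.
Proof. by rewrite /fail_factor; case: ifP => // _; exact: ruin_mono. Qed.

Lemma arm_cost_mono t i r : arm_cost t i r <= arm_cost t.+1 i r.
Proof. by apply: lee_wpmul2l; [rewrite lee_fin arm_weight_ge0|exact: visits_mono]. Qed.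

Lemma measurable_fail_factor t i r :
  measurable_fun setT (fun y : R => fail_factor t i (r + y - th)%R).
Proof.
rewrite /fail_factor; case: (1 - d <= arm i)%R; first exact: measurable_ruin_shift.
exact: measurable_cst.
Qed.

Lemma measurable_arm_cost t i r :
  measurable_fun setT (fun y : R => arm_cost t i (r + y - th)%R).
Proof. by apply: measurable_funeM; exact: measurable_visits_shift. Qed.

Lemma fail_factor_step t i r :
  \int[P (arm i)]_y fail_factor t i (r + y - th)%R <= fail_factor t.+1 i r.
Proof.
rewrite /fail_factor; case: (1 - d <= arm i)%R; first exact: ruin_step.
by rewrite integral_prob_cst.
Qed.

Lemma arm_cost_step t i r :
  (arm_weight i * (0 <= r)%R%:R)%:E +
    \int[P (arm i)]_y arm_cost t i (r + y - th)%R = arm_cost t.+1 i r.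
Proof.
rewrite /arm_cost ge0_integralZl_EFin ?arm_weight_ge0//; last 2 first.
- by move=> y _; exact: visits_ge0.
- exact: measurable_visits_shift.
rewrite [in RHS]/= [RHS]ge0_muleDr ?lee_fin// ?EFinM//.
by apply: integral_ge0 => y _; exact: visits_ge0.
Qed.

Lemma potential_ge0 t st : 0 <= potential t st.
Proof.
rewrite /potential !adde_ge0//.
- rewrite mule_ge0 ?lee_fin//; apply: prode_ge0 => i _; exact: fail_factor_ge0.
- by rewrite lee_fin !mulr_ge0.
- by apply: sume_ge0 => i _; exact: arm_cost_ge0.
Qed.

Lemma potential_update t st (a : 'I_k) y :
  potential t (greedy_update st a y) =
  (t%:R%:E * \prod_(i < k | i != a) fail_factor t i (walk_pos th st i)) *
    fail_factor t a (walk_pos th st a + y - th)%R +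
  ((t%:R * (3 * d))%:E + \sum_(i < k | i != a) arm_cost t i (walk_pos th st i)) +
  arm_cost t a (walk_pos th st a + y - th)%R.
Proof.
have rest (i : 'I_k) : i != a ->
    walk_pos th (greedy_update st a y) i = walk_pos th st i.
  by move=> ia; rewrite walk_pos_greedy_update val_eqE (negPf ia).
rewrite /potential (bigD1 a)//= (bigD1 a (P := predT))//=.
rewrite !walk_pos_greedy_update eqxx.
rewrite -!addeA; congr (_ + _).
  rewrite muleCA muleC; congr (_ * _ * _); apply: eq_bigr => i ia.
  by rewrite rest.
congr (_ + _); rewrite addeC; congr (_ + _); apply: eq_bigr => i ia.
by rewrite rest.
Qed.

Lemma measurable_potential t st (a : 'I_k) :
  measurable_fun setT (fun y : R => potential t (greedy_update st a y)).
Proof.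
under eq_fun do rewrite potential_update.
apply: emeasurable_funD; last exact: measurable_arm_cost.
apply: emeasurable_funD => //; apply: measurable_funeM.
exact: measurable_fail_factor.
Qed.

Lemma potential_step t st : wf_state st -> size st = k -> (0 < k)%N ->
  let a := greedy_choice st in
  (1 - arm a)%:E + \int[P (arm a)]_y potential t (greedy_update st a y) <=
  potential t.+1 st.
Proof.
move=> wf szst k0.
have alt : (greedy_choice st < k)%N by rewrite -szst greedy_choice_lt ?szst.
rewrite /=; have -> : greedy_choice st = Ordinal alt by [].
set a := Ordinal alt.
under eq_integral do rewrite potential_update.
set C := \prod_(i < k | i != a) fail_factor t i (walk_pos th st i).
set D := \sum_(i < k | i != a) arm_cost t i (walk_pos th st i).
have C0 : 0 <= C by apply: prode_ge0 => i _; exact: fail_factor_ge0.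
have D0 : 0 <= D by apply: sume_ge0 => i _; exact: arm_cost_ge0.
have d30 : 0 <= (t%:R * (3 * d))%:E by rewrite lee_fin !mulr_ge0.
have tC0 : 0 <= t%:R%:E * C by rewrite mule_ge0 ?lee_fin.
rewrite ge0_integralD//; last 4 first.
- by move=> y _; rewrite !adde_ge0// mule_ge0// fail_factor_ge0.
- apply: emeasurable_funD => //; apply: measurable_funeM.
  exact: measurable_fail_factor.
- by move=> y _; exact: arm_cost_ge0.
- exact: measurable_arm_cost.
rewrite ge0_integralD//; last 3 first.
- by move=> y _; rewrite mule_ge0// fail_factor_ge0.
- by apply: measurable_funeM; exact: measurable_fail_factor.
- by move=> y _; rewrite adde_ge0.
rewrite ge0_integralZl//; last 2 first.
- exact: measurable_fail_factor.
- by move=> y _; exact: fail_factor_ge0.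
rewrite integral_prob_cst.
set B := \prod_(i < k) fail_factor t.+1 i (walk_pos th st i).
have B0 : 0 <= B by apply: prode_ge0 => i _; exact: fail_factor_ge0.
set I := \int[_]_y fail_factor t a _.
set J := \int[_]_y arm_cost t a _.
have J0 : 0 <= J by apply: integral_ge0 => y _; exact: arm_cost_ge0.
(* Only the factor of [a] moves, and the other factors grow with the horizon. Of the [t + 1] copies
   of [B] in the current potential, one is left to pay for this round. *)
have hB : t%:R%:E * C * I <= t%:R%:E * B.
  rewrite -muleA lee_wpmul2l ?lee_fin// /B (bigD1 a)//= muleC.
  apply: lee_pmul => //.
  - by apply: integral_ge0 => y _; exact: fail_factor_ge0.
  - exact: fail_factor_step.
  by apply: lee_prod => i _; rewrite fail_factor_ge0 fail_factor_mono.
pose W := (arm_weight a * (0 <= walk_pos th st a)%R%:R)%R.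
have hS : W%:E + J + D <= \sum_(i < k) arm_cost t.+1 i (walk_pos th st i).
  rewrite (bigD1 a)//= arm_cost_step leeD2l//.
  by apply: lee_sum => i _; exact: arm_cost_mono.
(* If a good arm has a nonnegative walk, so has [a], and [3 * d] or [W] pays for it. Otherwise every
   factor of [B] is 1, and [B] alone pays since means are nonnegative. *)
have key : (1 - arm a)%:E <= B + (3 * d)%:E + W%:E.
  case: (pselect (exists i : 'I_k, (1 - d <= arm i)%R /\ (0 <= walk_pos th st i)%R)).
    move=> [i [_ ri]].
    have ra : (0 <= walk_pos th st a)%R.
      by apply: walk_pos_greedy_choice ri => //; rewrite szst.
    rewrite /W ra mulr1 -addeA -[leLHS]add0e leeD// -EFinD lee_fin /arm_weight.
    move: (arm a) (d0) => m d0'; clear -d0'.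
    by case: (ltP m (1 - 3 * d)%R) => h; lra.
  move=> alive; have -> : B = 1.
    rewrite /B big1// => i _; rewrite /fail_factor; case: ifPn => // gi.
    rewrite /=; case: ifPn => // ri; case: alive; exists i.
    by [].
  have W0 : (0 <= W)%R by rewrite mulr_ge0// arm_weight_ge0.
  have /andP[m0 _] := mus01 a; rewrite -!EFinD lee_fin.
  move: W W0 {hS} (arm a) m0 (d0) => w w0 m; clear -w0; lra.
rewrite /potential -/B -[t.+1%:R]natr1 [in X in X * B]EFinD ge0_muleDl ?lee_fin// mul1e.
rewrite [((t%:R + 1) * _)%R]mulrDl mul1r [in X in _ <= _ + X + _]EFinD.
apply: (@le_trans _ _ ((B + (3 * d)%:E + W%:E) +
   (t%:R%:E * B + ((t%:R * (3 * d))%:E + D) + J))).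
  by apply: leeD => //; apply: leeD2r; apply: leeD2r.
rewrite [leLHS](_ : _ = t%:R%:E * B + B + ((t%:R * (3 * d))%:E + (3 * d)%:E) +
   (W%:E + J + D)); first by rewrite leeD2l.
rewrite (AC (3*((1*2)*1))%AC ((4*1)*((5*2))*((3*7)*6))%AC)//.
Qed.

Hypothesis k0 : (0 < k)%N.

Lemma greedy_value_ge0 t st : 0 <= greedy_value P mus t st.
Proof.
elim: t st => [//|t IH] st /=; rewrite adde_ge0//.
  by rewrite lee_fin; have /andP[] := mus01 (greedy_choice st).
by apply: integral_ge0 => y _; exact: IH.
Qed.

(** Written as a sum, not as a difference, so that [cst_le_integralD] can integrate it with
    [potential] as the only measurable term. *)
Lemma greedy_valueD_potential t st : wf_state st -> size st = k ->
  t%:R%:E <= greedy_value P mus t st + potential t st.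
Proof.
elim: t st => [|t IH] st wf szst.
  by rewrite adde_ge0 ?potential_ge0.
have alt : (greedy_choice st < k)%N by rewrite -szst greedy_choice_lt ?szst.
apply: le_trans (leeD2l _ (potential_step t wf szst k0)) => /=.
set a := greedy_choice st.
have h : t%:R%:E <= \int[P (arm a)]_y greedy_value P mus t (greedy_update st a y)
   + \int[P (arm a)]_y potential t (greedy_update st a y).
  apply: cst_le_integralD => //.
  - by move=> y; exact: greedy_value_ge0.
  - exact: (measurable_potential t st (Ordinal alt)).
  - by move=> y; exact: potential_ge0.
  move=> y; apply: IH; first exact: wf_greedy_update.
  by rewrite size_greedy_update szst.
rewrite addeACA -EFinD subrKC -[t.+1%:R]natr1 addrC EFinD.
by rewrite leeD2l.
Qed.

Definition good_factor (b mu : R) : R := if (1 - d <= mu)%R then b else 1%R.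

Definition bad_cost (mu : R) : R :=
  if (mu < 1 - 3 * d)%R then (3 / ((1 - expR (-1)) / 2 * (th - mu)))%R else 0%R.

Lemma bad_cost_ge0 mu : (0 <= bad_cost mu)%R.
Proof.
rewrite /bad_cost; case: ifP => // h; apply: divr_ge0 => //.
have e1 : (0 <= 1 - expR (-1) :> R)%R by rewrite subr_ge0 expR_le1 oppr_le0.
by apply: mulr_ge0; [exact: divr_ge0|move: (d0); lra].
Qed.

(** A bad arm satisfies [1 - m = D + 2 * d <= 3 * D], as [d < D], while the expected visits are of
    order [1 / D ^ 2]; the product is of order [1 / D]. *)
Lemma arm_cost0_le t i : (0 < d)%R -> subgaussian1 (P (arm i)) (arm i) ->
  arm_cost t i 0%R <= (bad_cost (arm i))%:E.
Proof.
move=> dpos sg; rewrite /arm_cost /arm_weight /bad_cost.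
have /andP[m0 m1] := mus01 i.
set m := arm i in m0 m1 sg *; case: ltP => [m3|_]; last by rewrite mul0e.
set D := (th - m)%R.
have Dd : (d < D)%R by rewrite /D; lra.
have Dpos : (0 < D)%R by lra.
have D1 : (D <= 1)%R by rewrite /D; lra.
have m3D : (1 - m <= 3 * D)%R by rewrite /D; lra.
have mth : (m < th)%R by rewrite -subr_gt0.
apply: (@le_trans _ _ ((1 - m)%:E * ((1 - expR (- (D ^+ 2 / 2)))^-1)%:E)).
  apply: lee_wpmul2l; first by rewrite lee_fin subr_ge0.
  by apply: le_trans (visits_le_exp sg _ _ mth) _; rewrite mulr0 expR0 mul1r.
have D20 : (0 <= D ^+ 2 / 2)%R by rewrite divr_ge0// sqr_ge0.
(* Since [D <= 1], the quadratic bound gives [1 - expR (- (D ^ 2 / 2)) >= 3 / 8 * D ^ 2], and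
   [1 / 4 <= expR (-1)] makes [C1] at most [3 / 8]. *)
have e4 : (1 / 4 <= expR (-1) :> R)%R.
  have /(@expRN_le_quad R) : (0 <= 1 :> R)%R by [].
  have h := expR_ge1Dx (- 2^-1 : R).
  have -> : (-1 = - 2^-1 + - 2^-1 :> R)%R by field.
  by rewrite expRD => _; nra.
have q := expRN_le_quad D20.
have D2le : (D ^+ 2 <= 1)%R by rewrite expr_le1// ltW.
have D2pos : (0 < D ^+ 2)%R by rewrite exprn_gt0.
have C1pos : (0 < (1 - expR (-1)) / 2 :> R)%R.
  by rewrite divr_gt0// subr_gt0 expR_lt1 oppr_lt0.
set C1 := ((1 - expR (-1)) / 2)%R in C1pos *.
have lower : (C1 * D ^+ 2 <= 1 - expR (- (D ^+ 2 / 2)))%R.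
  by rewrite /C1; nra.
have lpos : (0 < C1 * D ^+ 2)%R by rewrite mulr_gt0.
rewrite -EFinM lee_fin.
apply: (@le_trans _ _ (3 * D / (C1 * D ^+ 2))%R).
  apply: ler_pM => //; first by rewrite subr_ge0.
    by rewrite invr_ge0 (le_trans (ltW lpos)).
  by rewrite lef_pV2// posrE// (lt_le_trans lpos).
rewrite le_eqVlt; apply/orP; left; apply/eqP; field.
by rewrite !gt_eqF.
Qed.

Lemma greedy_reward_ge b T : (0 < d)%R ->
  (forall i, subgaussian1 (P (arm i)) (arm i)) ->
  (forall i t, (1 - d <= arm i)%R -> ruin (P (arm i)) th t 0%R <= b%:E) ->
  T%:R%:E <= greedy_reward P T mus +
    ((T%:R * \prod_(i < k) good_factor b (arm i))%:E + (T%:R * (3 * d))%:E +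
     \sum_(i < k) (bad_cost (arm i))%:E).
Proof.
move=> dpos sg ruinb.
have pos0 i : walk_pos th (nseq k (0%N, 0%R)) i = 0%R.
  by rewrite /walk_pos nth_nseq; case: ifP => _ /=; rewrite mul0r subr0.
apply: le_trans (@greedy_valueD_potential T (nseq k (0%N, 0%R)) _ _) _.
- by move=> i; rewrite nth_nseq; case: ifP.
- by rewrite size_nseq.
rewrite leeD2l// /potential leeD//; last first.
  by apply: lee_sum => i _; rewrite pos0 arm_cost0_le.
rewrite leeD2r// EFinM lee_wpmul2l ?lee_fin//.
rewrite -prodEFin; apply: lee_prod => i _.
rewrite fail_factor_ge0 /= pos0 /fail_factor /good_factor.
by case: ifP => // h; exact: ruinb.
Qed.

End potential.

(** * Averaging over the prior *)

Section prior.
Variables (R : realType) (Gamma : probability R R).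
Hypothesis Gamma01 : prior_on_unit Gamma.

(** Independence of the means, in a form that leaves [F] arbitrary: its bound is a sum of products
    of one-arm functions, and each integration replaces one factor by its mean. In the induction the
    factor of the first arm is absorbed into [A]. *)
Lemma prior_expect_le (k : nat) (J : finType) (c : R) (A : J -> R)
    (g : J -> 'I_k -> R -> R) (v : J -> 'I_k -> R) (F : seq R -> \bar R) :
  0 <= c -> (forall j, 0 <= A j) -> (forall j i x, 0 <= g j i x) ->
  (forall j i, measurable_fun setT (g j i)) ->
  (forall j i, (\int[Gamma]_x (g j i x)%:E <= (v j i)%:E)%E) ->
  (forall mus, size mus = k -> (forall i, 0 <= nth 0 mus i <= 1) ->
    (F mus <= (c + \sum_j A j * \prod_i g j i (nth 0 mus i))%:E)%E) ->
  (prior_expect Gamma k F <= (c + \sum_j A j * \prod_i v j i)%:E)%E.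
Proof.
move=> c0 + + + +; elim: k => [|k IH] in A g v F *.
  move=> A0 g0 mg gv /(_ [::] erefl) FA /=; apply: le_trans (FA _) _.
    by move=> i; rewrite nth_nil lexx ler01.
  by rewrite lee_fin lerD2l; apply: ler_sum => j _; rewrite !big_ord0.
move=> A0 g0 mg gv FA /=.
have v0 j i : 0 <= v j i.
  rewrite -lee_fin; apply: le_trans (gv j i); apply: integral_ge0 => x _.
  by rewrite lee_fin.
pose B j := A j * \prod_(i < k) v j (lift ord0 i).
have B0 j : 0 <= B j by rewrite mulr_ge0// prodr_ge0.
apply: (@le_trans _ _
  (\int[Gamma]_x (c%:E + \sum_j (B j)%:E * (g j ord0 x)%:E))%E).
  apply: (@integral_le_on _ _ _ Gamma [set` `[0, 1]]) => //.
  - apply: emeasurable_funD => //; apply: emeasurable_sum => j.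
    by apply: measurable_funeM; apply/measurable_EFinP.
  - move=> x; rewrite adde_ge0 ?lee_fin//; apply: sume_ge0 => j _.
    by rewrite mule_ge0 ?lee_fin.
  move=> x; rewrite /= in_itv /= => x01.
  apply: le_trans (IH (fun j => A j * g j ord0 x) (fun j i => g j (lift ord0 i))
    (fun j i => v j (lift ord0 i)) _ _ _ _ _ _) _ => //.
  - by move=> j; rewrite mulr_ge0.
  - move=> s szs s01; apply: le_trans (FA (x :: s) _ _) _.
    + by rewrite /= szs.
    + by case.
    rewrite lee_fin lerD2l; apply: ler_sum => j _.
    by rewrite big_ord_recl mulrA lexx.
  rewrite sumEFin -EFinD lee_fin lerD2l; apply: ler_sum => j _.
  by rewrite /B mulrAC.
rewrite ge0_integralD//; last 2 first.
- by move=> x _; apply: sume_ge0 => j _; rewrite mule_ge0 ?lee_fin.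
- apply: emeasurable_sum => j; apply: measurable_funeM.
  exact/measurable_EFinP.
rewrite integral_prob_cst ge0_integral_sum//; last 2 first.
- by move=> j; apply: measurable_funeM; exact/measurable_EFinP.
- by move=> j x _; rewrite mule_ge0 ?lee_fin.
rewrite EFinD leeD2l// -sumEFin; apply: lee_sum => j _.
rewrite ge0_integralZl_EFin//; last 2 first.
- by move=> x _; rewrite lee_fin.
- exact/measurable_EFinP.
rewrite big_ord_recl mulrCA [leRHS](_ : _ = (B j)%:E * (v j ord0)%:E)%E.
  by rewrite lee_wpmul2l ?lee_fin.
by rewrite -EFinM mulrC.
Qed.

Lemma eq_prior_expect k (F G : seq R -> \bar R) :
  (forall mus, size mus = k -> F mus = G mus) ->
  prior_expect Gamma k F = prior_expect Gamma k G.
Proof.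
elim: k F G => [|k IH] F G FG /=; first exact: FG.
apply: eq_integral => x _; apply: IH => s szs.
by apply: FG; rewrite /= szs.
Qed.

Lemma BR_greedyE (P : R -> probability R R) T k :
  BR_greedy Gamma P T k = BR_ssgreedy Gamma P T k k.
Proof.
apply: eq_prior_expect => mus szm.
rewrite binn invr1 mul1e (big_pred1 (finset.setTfor 'I_k)); last first.
  move=> S; rewrite /= finset.eqEcard finset.subsetT/= finset.cardsT card_ord.
  by rewrite eqn_leq -[X in (_ <= X)%N && _](card_ord k) max_card.
congr (_ - greedy_reward P T _)%E.
rewrite enum_setT -enumT -[LHS](mkseq_nth 0) szm /mkseq -val_enum_ord -map_comp.
by [].
Qed.

Variables (P : R -> probability R R) (d b gb hb : R) (T k m : nat).
Hypothesis sgP : forall mu : R, 0 <= mu <= 1 -> subgaussian1 (P mu) mu.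
Hypotheses (d0 : 0 < d) (b0 : 0 <= b).
Hypothesis ruinb : forall mu t, 1 - d <= mu <= 1 ->
  (ruin (P mu) (1 - 2 * d) t 0 <= b%:E)%E.
Hypotheses (m0 : (0 < m)%N) (mk : (m <= k)%N).
Hypothesis gbE : (\int[Gamma]_x (good_factor d b x)%:E <= gb%:E)%E.
Hypothesis hbE : (\int[Gamma]_x (bad_cost d x)%:E <= hb%:E)%E.

Lemma measurable_good_factor : measurable_fun setT (good_factor d b).
Proof. by apply: measurable_fun_ifT => //; exact: measurable_fun_ler. Qed.

Lemma measurable_bad_cost : measurable_fun setT (bad_cost d).
Proof.
pose h x := (1 - expR (-1)) / 2 * (1 - 2 * d - x) : R.
(* Where [x < 1 - 3 * d] the base [h x] is nonnegative, so the real power -1 agrees with the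
   inverse. *)
rewrite (_ : bad_cost d = fun x => if x < 1 - 3 * d then 3 * h x `^ (-1) else 0).
  apply: measurable_fun_ifT => //; first exact: measurable_fun_ltr.
  apply: measurable_funM => //.
  apply: (measurableT_comp (@measurable_powR R (-1))).
  by apply: measurable_funM => //; exact: measurable_funB.
apply/funext => x; rewrite /bad_cost; case: ifP => // xd.
rewrite powR_inv1// /h; apply: mulr_ge0; last by move: d0; lra.
by rewrite divr_ge0// subr_ge0 expR_le1 oppr_le0.
Qed.

Lemma good_factor_ge0 x : 0 <= good_factor d b x.
Proof. by rewrite /good_factor; case: ifP. Qed.

Lemma seqmax_le1 (mus : seq R) : (forall i, 0 <= nth 0 mus i <= 1) ->
  seqmax mus <= 1.
Proof.
move=> h; rewrite /seqmax big_seq_cond.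
elim/big_rec: _ => [|x y xm y1]; first exact: ler01.
rewrite andbT in xm; have /(nthP 0)[i _ <-] := xm.
by rewrite ge_max y1 andbT; have /andP[] := h i.
Qed.

Lemma sumr_draws (x : R) :
  \sum_(S : {set 'I_k} | #|S| == m) x = 'C(k, m)%:R * x.
Proof. by rewrite sumr_const -cardsE card_draws card_ord mulr_natl. Qed.

Lemma regret_draws_le (mus : seq R) : size mus = k ->
  (forall i, 0 <= nth 0 mus i <= 1) ->
  ((T%:R * seqmax mus)%:E - (('C(k, m)%:R)^-1)%:E *
     \sum_(S : {set 'I_k} | #|S| == m)
        greedy_reward P T [seq nth 0%R mus (val i) | i <- enum S] <=
   (T%:R * (3 * d) + 'C(k, m)%:R^-1 * \sum_(S : {set 'I_k} | #|S| == m)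
      (T%:R * \prod_(i in S) good_factor d b (nth 0 mus i) +
       \sum_(i in S) bad_cost d (nth 0 mus i)))%:E)%E.
Proof.
move=> szm mus01; set c := 'C(k, m)%:R : R.
have c0 : 0 < c by rewrite ltr0n bin_gt0.
pose V (S : {set 'I_k}) := T%:R * \prod_(i in S) good_factor d b (nth 0 mus i) +
       \sum_(i in S) bad_cost d (nth 0 mus i).
have rewS (S : {set 'I_k}) : #|S| == m ->
    ((T%:R - (T%:R * (3 * d) + V S))%:E <=
    greedy_reward P T [seq nth 0%R mus (val i) | i <- enum S])%E.
  move=> /eqP Sm; set s := [seq _ | _ <- _].
  have s01 i : 0 <= nth 0 s i <= 1.
    have [ilt|ige] := ltnP i (size s); last by rewrite nth_default// lexx ler01.
    by have /mapP[j _ ->] := mem_nth 0 ilt.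
  have s0 : (0 < size s)%N by rewrite size_map -cardE Sm.
  have := greedy_reward_ge s01 (ltW d0) s0 (b := b) T d0
    (fun i => sgP (s01 i)) _.
  rewrite EFinB leeBlDr// => /(_ _)/le_trans; apply.
    by move=> i t gi; apply: ruinb; rewrite gi; have /andP[] := s01 i.
  rewrite leeD2l// sumEFin -!EFinD lee_fin /V.
  have -> : \prod_(i < size s) good_factor d b (nth 0 s i) =
      \prod_(i in S) good_factor d b (nth 0 mus i).
    by rewrite -(big_mkord predT (fun i => good_factor d b (nth 0 s i)))
      -(big_nth 0 predT) big_map big_enum.
  have -> : \sum_(i < size s) bad_cost d (nth 0 s i) =
      \sum_(i in S) bad_cost d (nth 0 mus i).
    by rewrite -(big_mkord predT (fun i => bad_cost d (nth 0 s i)))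
      -(big_nth 0 predT) big_map big_enum.
  by lra.
apply: (@le_trans _ _ (T%:R%:E - (c^-1)%:E * \sum_(S : {set 'I_k} | #|S| == m)
   (T%:R - (T%:R * (3 * d) + V S))%:E)%E).
  apply: leeB.
    rewrite lee_fin -[leRHS]mulr1 ler_wpM2l//; exact: seqmax_le1.
  apply: lee_wpmul2l; first by rewrite lee_fin invr_ge0 ltW.
  exact: lee_sum.
rewrite sumEFin -EFinM -EFinB lee_fin !sumrB !big_split /=.
rewrite !sumr_draws -/c.
rewrite le_eqVlt; apply/orP; left; apply/eqP; field.
by rewrite gt_eqF.
Qed.

Lemma BR_ssgreedy_le :
  (BR_ssgreedy Gamma P T k m <=
   (T%:R * (3 * d) + (T%:R * gb ^+ m + m%:R * hb))%:E)%E.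
Proof.
set c := 'C(k, m)%:R : R.
have c0 : 0 < c by rewrite ltr0n bin_gt0.
(* Writes the bound of [regret_draws_le] as a sum of products: [inl U] is the failure product of the
   draw [U], and [inr (U, i)] the cost of arm [i] in it. Sets of the wrong size and arms outside [U]
   get coefficient 0. *)
pose J := ({set 'I_k} + {set 'I_k} * 'I_k)%type.
pose A (j : J) : R := match j with
  | inl U => if #|U| == m then c^-1 * T%:R else 0
  | inr (U, i) => if (#|U| == m) && (i \in U) then c^-1 else 0 end.
pose g (j : J) (i : 'I_k) : R -> R := match j with
  | inl U => if i \in U then good_factor d b else cst 1
  | inr (U, i') => if i == i' then bad_cost d else cst 1 end.
pose v (j : J) (i : 'I_k) : R := match j with
  | inl U => if i \in U then gb else 1
  | inr (U, i') => if i == i' then hb else 1 end.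
have prod_in (S : {set 'I_k}) (f : 'I_k -> R) :
    \prod_i (if i \in S then f i else 1) = \prod_(i in S) f i.
  by rewrite [RHS]big_mkcond.
have prod_pred1 (i' : 'I_k) (f : 'I_k -> R) :
    \prod_i (if i == i' then f i else 1) = f i'.
  by rewrite (bigD1 i')//= eqxx big1 ?mulr1// => i /negPf ->.
have sumA (f : {set 'I_k} -> R) (h : 'I_k -> R) (w : J -> R) :
   (forall S, w (inl S) = f S) -> (forall S i, w (inr (S, i)) = h i) ->
   \sum_j A j * w j = c^-1 * \sum_(S : {set 'I_k} | #|S| == m)
     (T%:R * f S + \sum_(i in S) h i).
  move=> wl wr; rewrite big_sumType /= big_split /= mulrDr; congr (_ + _).
    rewrite mulr_sumr [RHS]big_mkcond; apply: eq_bigr => S _; rewrite wl.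
    by case: ifP => _; rewrite ?mul0r ?mulrA.
  rewrite (eq_bigr (fun p => A (inr (p.1, p.2)) * w (inr (p.1, p.2)))); last by case.
  rewrite -(pair_bigA _ (fun S i => A (inr (S, i)) * w (inr (S, i)))) /=.
  rewrite mulr_sumr [RHS]big_mkcond; apply: eq_bigr => S _.
  case: ifP => Sm /=; last by rewrite big1// => i _; rewrite mul0r.
  rewrite mulr_sumr [RHS]big_mkcond; apply: eq_bigr => i _; rewrite wr.
  by case: ifP => _; rewrite ?mul0r.
apply: le_trans (@prior_expect_le k J (T%:R * (3 * d)) A g v _ _ _ _ _ _ _) _.
- by rewrite !mulr_ge0// ltW.
- by case=> [S|[S i]] /=; case: ifP => // _; rewrite ?mulr_ge0// ?invr_ge0 ltW.
- case=> [S|[S i']] i x /=; case: ifP => // _; first exact: good_factor_ge0.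
  exact: bad_cost_ge0 (ltW d0) _.
- case=> [S|[S i']] i /=; case: ifP => // _; first exact: measurable_good_factor.
  exact: measurable_bad_cost.
- by case=> [S|[S i']] i /=; case: ifP => // _; rewrite (integral_prob_cst Gamma 1).
- move=> mus szm mus01; apply: le_trans (regret_draws_le szm mus01) _.
  rewrite lee_fin lerD2l -/c (sumA (fun S => \prod_(i in S) good_factor d b (nth 0 mus i))
    (fun i => bad_cost d (nth 0 mus i)))//.
    move=> S; rewrite -prod_in; apply: eq_bigr => i _ /=.
    by case: ifP.
  move=> S i' /=; rewrite -[RHS](prod_pred1 i' (fun i => bad_cost d (nth 0 mus i))).
  by apply: eq_bigr => i _; case: ifP.
rewrite lee_fin lerD2l (sumA (fun S => \prod_(i in S) gb) (fun=> hb))//; last 2 first.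
- by move=> S /=; rewrite prod_in.
- by move=> S i' /=; rewrite (prod_pred1 i' (fun=> hb)).
rewrite (eq_bigr (fun=> T%:R * gb ^+ m + m%:R * hb)); last first.
  by move=> S /eqP Sm; rewrite prodr_const sumr_const Sm [m%:R * hb]mulr_natl.
by rewrite sumr_draws mulrA mulVf ?gt_eqF// mul1r.
Qed.

End prior.

(** * Integrals against a regular prior *)

Section regular_prior.
Variables (R : realType) (Gamma : probability R R) (c0 C0 : R).
Hypothesis Gamma01 : prior_on_unit Gamma.
Hypothesis Gammareg : one_regular Gamma c0 C0.

Lemma measurable_tail (e : R) : measurable [set x : R | 1 - e <= x].
Proof. by rewrite -[X in measurable X]setTI; exact: measurable_fun_ler. Qed.

Lemma measurable_open_tail (e : R) : measurable [set x : R | 1 - e < x].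
Proof. by rewrite -[X in measurable X]setTI; exact: measurable_fun_ltr. Qed.

(* The last two clauses of [one_regular] are joined by the division of the
   field [bool], which is a conjunction. *)
Lemma one_regularP (e : R) : 0 < e <= 1 ->
  ((c0 * e)%:E <= Gamma [set x : R | (1 - e < x)%R])%E /\
  (Gamma [set x : R | (1 - e <= x)%R] <= (C0 * e)%:E)%E.
Proof.
move=> /Gammareg[hl hu]; split => //.
by move: hu; case: (_ <= (C0 * e)%:E)%E => //; rewrite mulr0.
Qed.

Lemma regular_ge1 : 1 <= C0.
Proof.
have [|_ h] := @one_regularP 1; first by rewrite ltr01 lexx.
rewrite -lee_fin -[C0]mulr1; apply: le_trans h.
have <- : Gamma [set` `[0%R, 1%R]] = 1%E := Gamma01.
apply: le_measure; rewrite ?inE//; first exact: measurable_tail.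
by move=> x /=; rewrite in_itv /= subrr => /andP[].
Qed.

(** For [e > 1] the bound is trivial by [regular_ge1]; tails as long as [2 * d + 1] occur below. *)
Lemma regular_tail_le (e : R) : 0 < e ->
  (Gamma [set x : R | (1 - e <= x)%R] <= (C0 * e)%:E)%E.
Proof.
move=> e0; have [e1|e1] := leP e 1.
  by have [|] := @one_regularP e; first by rewrite e0.
apply: le_trans (probability_le1 _ _) _; first exact: measurable_tail.
by rewrite lee_fin; have := regular_ge1; nra.
Qed.

(** Provides a mean whose ruin probability lies between 0 and the bound [b] used later, which shows
    [0 <= b]. *)
Lemma exists_good_mean (d : R) : 0 < c0 -> 0 < d <= 1 ->
  exists2 mu : R, 1 - d <= mu & mu <= 1.
Proof.
move=> c0pos d01; have [tl _] := one_regularP d01; have /andP[d0 _] := d01.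
apply: contrapT => nex.
have : (Gamma [set x : R | (1 - d < x)%R] <= Gamma (~` [set` `[0%R, 1%R]]))%E.
  apply: le_measure; rewrite ?inE//; first exact: measurable_open_tail.
    exact: measurableC.
  move=> x /= dx; rewrite in_itv /= => /andP[_ x1].
  by apply: nex; exists x => //; exact: ltW.
have -> : Gamma (~` [set` `[0%R, 1%R]]) = 0%E.
  have := probability_setC Gamma (measurable_itv `[0%R, 1%R]).
  by rewrite (Gamma01 : Gamma _ = 1%E) subee.
by move=> /(le_trans tl); rewrite lee_fin leNgt mulr_gt0.
Qed.

Lemma integral_good_factor_le (d b : R) : 0 < d <= 1 -> 0 <= b <= 1 ->
  (\int[Gamma]_x (good_factor d b x)%:E <= (1 - c0 * d * (1 - b))%:E)%E.
Proof.
move=> d01 /andP[b0 b1]; have [tl _] := one_regularP d01.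
set D := [set x : R | 1 - d <= x].
have mD : measurable D by exact: measurable_tail.
have tD : ((c0 * d)%:E <= Gamma D)%E.
  apply: le_trans tl _; apply: le_measure; rewrite ?inE//.
    exact: measurable_open_tail.
  by move=> x /= /ltW.
have b1' : 0 <= 1 - b by rewrite subr_ge0.
have : (\int[Gamma]_x ((good_factor d b x)%:E + (1 - b)%:E * (\1_D x)%:E) = 1)%E.
  rewrite -[RHS](integral_prob_cst Gamma); apply: eq_integral => x _.
  rewrite indicE /good_factor -EFinM -EFinD; case: ifPn => h.
    by rewrite mem_set// mulr1 addrC subrK.
  by rewrite memNset ?mulr0 ?addr0//; exact/negP.
rewrite ge0_integralD//; last 4 first.
- by move=> x _; rewrite lee_fin good_factor_ge0.
- by apply/measurable_EFinP; exact: measurable_good_factor.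
- by move=> x _; rewrite mule_ge0 ?lee_fin.
- by apply: measurable_funeM; apply/measurable_EFinP.
rewrite ge0_integralZl_EFin//; last exact/measurable_EFinP.
rewrite integral_indic// setIT => h1.
rewrite EFinB leeBrDr// -[leRHS]h1 leeD2l// mulrC EFinM.
exact: lee_wpmul2l.
Qed.

(* Discrete layer-cake formula for [1 / y]. *)
Lemma inv_le_grid (x : nat -> R) n (y : R) :
  (forall i, 0 < x i) -> (forall i, x i <= x i.+1) -> x 0%N <= y -> y <= x n ->
  y^-1 <= (x n)^-1 + \sum_(i < n) ((x i)^-1 - (x i.+1)^-1) * (y <= x i.+1)%R%:R.
Proof.
move=> x0 xmon; elim: n => [|n IH] y0 yn.
  by rewrite big_ord0 addr0 (@le_anti _ _ (x 0%N) y) ?y0.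
rewrite big_ord_recr /= yn mulr1.
have w0 i : 0 <= (x i)^-1 - (x i.+1)^-1.
  by rewrite subr_ge0 lef_pV2 ?posrE.
have [yle|/ltW ylt] := leP y (x n).
  by have := IH y0 yle; lra.
have : y^-1 <= (x n)^-1 by rewrite lef_pV2 ?posrE// (lt_le_trans (x0 n)).
have : 0 <= \sum_(i < n) ((x i)^-1 - (x i.+1)^-1) * (y <= x i.+1)%R%:R.
  by apply: sumr_ge0 => i _; rewrite mulr_ge0.
lra.
Qed.

(** On the relevant means the gap [1 - 2 * d - mu] lies between [d] and 1, and it is at most
    [x i.+1] exactly on a tail of length [2 * d + x i.+1]. *)
Lemma integral_inv_gap_le_grid (d : R) (x : nat -> R) n : 0 < d ->
  (forall i, 0 < x i) -> (forall i, x i <= x i.+1) -> x 0%N = d -> x n = 1 ->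
  (\int[Gamma]_mu ((if (mu < 1 - 3 * d)%R then (1 - 2 * d - mu)^-1 else 0)%:E) <=
   (1 + C0 * \sum_(i < n) ((x i)^-1 - (x i.+1)^-1) * (2 * d + x i.+1))%:E)%E.
Proof.
move=> d0 x0 xmon xd x1.
pose D i := [set mu : R | 1 - (2 * d + x i.+1) <= mu].
have mD i : measurable (D i) by exact: measurable_tail.
pose w i := (x i)^-1 - (x i.+1)^-1.
have w0 i : 0 <= w i by rewrite subr_ge0 lef_pV2 ?posrE.
apply: (@le_trans _ _
  (\int[Gamma]_mu (1%:E + \sum_(i < n) (w i)%:E * (\1_(D i) mu)%:E))%E).
  apply: (@integral_le_on _ _ _ Gamma [set` `[0, 1]]) => //.
  - apply: emeasurable_funD => //; apply: emeasurable_sum => i.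
    by apply: measurable_funeM; apply/measurable_EFinP.
  - move=> mu; rewrite adde_ge0//; apply: sume_ge0 => i _.
    by rewrite mule_ge0 ?lee_fin.
  move=> mu /=; rewrite in_itv /= => /andP[mu0 mu1].
  rewrite sumEFin -EFinD lee_fin; case: ifPn => [mud|_]; last first.
    by rewrite addr_ge0// sumr_ge0// => i _; rewrite mulr_ge0.
  have h1 : x 0%N <= 1 - 2 * d - mu by rewrite xd; lra.
  have h2 : 1 - 2 * d - mu <= x n by rewrite x1; lra.
  apply: le_trans (inv_le_grid x0 xmon h1 h2) _.
  rewrite x1 invr1 lerD2l; apply: ler_sum => i _; apply: ler_wpM2l; first exact: w0.
  rewrite indicE.
  case: (leP (1 - 2 * d - mu) (x i.+1)) => // h.
  by rewrite mem_set// /D /=; lra.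
rewrite ge0_integralD//; last 2 first.
- move=> mu _; apply: sume_ge0 => i _; by rewrite mule_ge0 ?lee_fin.
- by apply: emeasurable_sum => i; apply: measurable_funeM; apply/measurable_EFinP.
rewrite (integral_prob_cst Gamma 1%E) ge0_integral_sum//; last 2 first.
- by move=> i; apply: measurable_funeM; apply/measurable_EFinP.
- by move=> i mu _; rewrite mule_ge0 ?lee_fin.
rewrite EFinD leeD2l// mulr_sumr -sumEFin; apply: lee_sum => i _.
rewrite ge0_integralZl_EFin//; last exact/measurable_EFinP.
rewrite integral_indic// setIT mulrCA EFinM.
apply: lee_wpmul2l; first by rewrite lee_fin; exact: w0.
apply: regular_tail_le; rewrite addr_gt0// mulr_gt0//.
Qed.

(** Term [i] equals [2 * (r ^ (- i) - r ^ (- i - 1)) + (r - 1)]: the first part telescopes, the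
    second is constant. *)
Lemma geometric_grid_sum (d r : R) n : 0 < d -> 0 < r -> d * r ^+ n = 1 ->
  \sum_(i < n) ((d * r ^+ i)^-1 - (d * r ^+ i.+1)^-1) * (2 * d + d * r ^+ i.+1) <=
  2 + n%:R * (r - 1).
Proof.
move=> d0 r0 dr.
have -> : \sum_(i < n) ((d * r ^+ i)^-1 - (d * r ^+ i.+1)^-1) *
    (2 * d + d * r ^+ i.+1) =
    2 * (1 - (r ^+ n)^-1) + n%:R * (r - 1).
  elim: (n) => [|j IH]; first by rewrite big_ord0 expr0 invr1 subrr mulr0 mul0r addr0.
  rewrite big_ord_recr /= IH !exprS -[j.+1%:R]natr1.
  have rj : 0 < r ^+ j by exact: exprn_gt0.
  by field; rewrite !gt_eqF.
by rewrite lerD2r; have := exprn_gt0 n r0; rewrite -invr_gt0; lra.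
Qed.

Lemma integral_bad_cost_le (d : R) : 0 < d < 1 ->
  (\int[Gamma]_mu (bad_cost d mu)%:E <=
   (3 / ((1 - expR (-1)) / 2) * (C0 * (5 - ln d)))%:E)%E.
Proof.
move=> /andP[d0 d1]; pose L := - ln d.
have L0 : 0 < L by rewrite oppr_gt0 ln_lt0// d0.
(* A grid this fine brings [n * (r - 1)] within 1 of its limit [L]: from [r <= n / (n - L)] one gets
   at most [n * L / (n - L)], which is at most [L + 1] once [n >= L ^ 2 + L]. *)
have [n nL] : exists n, L ^+ 2 + L < n%:R.
  by exists (Num.truncn (L ^+ 2 + L)).+1; exact: truncnS_gt.
have n0 : 0 < n%:R :> R.
  by apply: le_lt_trans nL; rewrite addr_ge0 ?sqr_ge0// ltW.
pose r := expR (L / n%:R).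
have r0 : 0 < r by exact: expR_gt0.
have r1 : 1 <= r by rewrite -expR0 ler_expR divr_ge0// ltW.
have rn : d * r ^+ n = 1.
  by rewrite /r -expRM_natr divfK ?gt_eqF// /L expRN lnK ?posrE// divff ?gt_eqF.
have step : n%:R * (r - 1) <= L + 1.
  have h : 1 - L / n%:R <= expR (- (L / n%:R)) := expR_ge1Dx _.
  have re : r * expR (- (L / n%:R)) = 1 by rewrite expRxMexpNx_1.
  have h2 : r * (1 - L / n%:R) <= 1.
    by rewrite -[leRHS]re ler_wpM2l// ltW.
  have h3 : r * (n%:R - L) <= n%:R.
    have -> : n%:R - L = n%:R * (1 - L / n%:R) by field; rewrite gt_eqF.
    by rewrite mulrCA ler_piMr// ltW.
  have nLpos : 0 < n%:R - L by have := sqr_ge0 L; lra.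
  rewrite -(ler_pM2r nLpos).
  have -> : n%:R * (r - 1) * (n%:R - L) = n%:R * (r * (n%:R - L) - (n%:R - L)).
    by ring.
  apply: (@le_trans _ _ (n%:R * L)); last by nra.
  by apply: ler_wpM2l; [exact: ltW|lra].
set C1 := (1 - expR (-1)) / 2 : R.
have C1pos : 0 < C1 by rewrite divr_gt0// subr_gt0 expR_lt1 oppr_lt0.
have k0 : 0 <= 3 / C1 by rewrite divr_ge0// ltW.
pose f mu : R := if (mu < 1 - 3 * d)%R then (1 - 2 * d - mu)^-1 else 0.
have f0 mu : 0 <= f mu.
  by rewrite /f; case: ifP => // h; rewrite invr_ge0; lra.
have bf mu : bad_cost d mu = 3 / C1 * f mu.
  rewrite /bad_cost -/C1 /f; case: ifP => _; last by rewrite mulr0.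
  by rewrite invfM mulrA.
have mf : measurable_fun setT f.
  have -> : f = fun mu => (3 / C1)^-1 * bad_cost d mu.
    by apply/funext => mu; rewrite bf mulKf// gt_eqF// divr_gt0.
  by apply: measurable_funM => //; exact: measurable_bad_cost.
under eq_integral do rewrite bf EFinM.
rewrite ge0_integralZl_EFin//; last 2 first.
- by move=> mu _; rewrite lee_fin.
- exact/measurable_EFinP.
rewrite [leRHS]EFinM; apply: lee_wpmul2l; first by rewrite lee_fin.
have gpos i : 0 < d * r ^+ i by rewrite mulr_gt0// exprn_gt0.
have gmon i : d * r ^+ i <= d * r ^+ i.+1.
  apply: ler_wpM2l; first exact: ltW.
  by rewrite exprS ler_peMl// exprn_ge0// ltW.
apply: le_trans (@integral_inv_gap_le_grid d (fun i => d * r ^+ i) n d0 gpos gmon _ rn) _.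
  by rewrite expr0 mulr1.
have C1ge := regular_ge1.
rewrite lee_fin; have := geometric_grid_sum d0 r0 rn.
set S := \sum_(i < n) _ => hS.
have : C0 * S <= C0 * (2 + (L + 1)).
  by rewrite ler_wpM2l ?(le_trans _ C1ge)// (le_trans hS)// lerD2l.
by rewrite -[ln d]opprK -/L; nra.
Qed.

End regular_prior.

(** * Regret bounds *)

Section regret_bound.
Variables (R : realType) (Gamma : probability R R) (P : R -> probability R R).
Variables (c0 C0 p0 delta0 : R).
Hypothesis Gamma01 : prior_on_unit Gamma.
Hypothesis c0pos : 0 < c0.
Hypothesis Gammareg : one_regular Gamma c0 C0.
Hypothesis meanP : forall mu : R, 0 <= mu <= 1 -> has_mean (P mu) mu.
Hypothesis sgP : forall mu : R, 0 <= mu <= 1 -> subgaussian1 (P mu) mu.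
Hypotheses (p0pos : 0 < p0) (delta0pos : 0 < delta0).
Hypothesis upP : uniformly_upward_looking P p0 delta0.

(** The gap [mu - (1 - 2 * d)] lies between [d] and [2 * d], so [d <= 1 / 20] meets the requirement
    of [ruin0_upward]; the 8 there is relaxed to [4 * expR 1]. *)
Lemma ruin0_uniform (d mu : R) t : 0 < d -> d <= 20^-1 -> d <= delta0 ->
  1 - d <= mu <= 1 ->
  (ruin (P mu) (1 - 2 * d) t 0 <= (1 - p0 * d / (4 * expR 1))%:E)%E.
Proof.
move=> d0 d20 dd0 /andP[mud mu1].
have mu01 : 0 <= mu <= 1 by rewrite mu1 andbT; lra.
have up : upward_looking (P mu) mu p0 by apply: upP; rewrite mu1 andbT; lra.
apply: le_trans (ruin0_upward (sgP mu01) up t (meanP mu01) (ltW p0pos) _ _) _.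
- by apply/andP; split; lra.
- by lra.
have e2 : 2 <= expR 1 :> R by have := expR_ge1Dx (1 : R); lra.
rewrite lee_fin lerD2l lerN2 -!mulrA; apply: ler_wpM2l; first exact: ltW.
rewrite ler_pdivrMr; last by lra.
by nra.
Qed.

Lemma BR_ssgreedy_bound (T k m : nat) : (1 < T)%N -> (m <= k)%N ->
  4 * expR 1 * ln T%:R * Num.max 400 (1 / delta0 ^+ 2) / (c0 * p0) <= m%:R ->
  (BR_ssgreedy Gamma P T k m <=
    (1 + 3 * T%:R * Num.sqrt (4 * expR 1 * ln T%:R / (m%:R * c0 * p0))
     + 3 * C0 * m%:R / (2 * ((1 - expR (-1)) / 2)) *
       (10 + ln (m%:R * c0 * p0 / (4 * expR 1)) - ln (ln T%:R)))%:E)%E.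
Proof.
move=> T1 mk; set X := 4 * expR 1 * ln T%:R; set M := Num.max _ _ => mbig.
have e0 : 0 < expR 1 :> R := expR_gt0 1.
have l0 : 0 < ln T%:R :> R by rewrite ln_gt0// ltr1n.
have X0 : 0 < X by rewrite /X !mulr_gt0.
have cp : 0 < c0 * p0 by exact: mulr_gt0.
have M400 : 400 <= M by rewrite /M le_max lexx.
have Md : 1 / delta0 ^+ 2 <= M by rewrite /M le_max lexx orbT.
have m0 : 0 < m%:R :> R.
  by apply: lt_le_trans mbig; rewrite divr_gt0// mulr_gt0//; lra.
have mcp : 0 < m%:R * c0 * p0 by rewrite -mulrA mulr_gt0.
have XM : X * M <= m%:R * c0 * p0 by rewrite -mulrA -ler_pdivrMr.
set d2 := X / (m%:R * c0 * p0); set d := Num.sqrt d2.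
have d20 : 0 < d2 by exact: divr_gt0.
have d0 : 0 < d by rewrite sqrtr_gt0.
have dd : d ^+ 2 = d2 by rewrite sqr_sqrtr// ltW.
have dM : d ^+ 2 * M <= 1.
  by rewrite dd /d2 mulrAC ler_pdivrMr// mul1r.
(* The 400 in [M] is [20 ^ 2]; the other entry of the maximum gives [d <= delta0]. *)
have dle20 : d <= 20^-1.
  rewrite leNgt; apply/negP => h.
  have : 20^-1 * 20^-1 < d * d by apply: ltr_pM.
  by rewrite -expr2; nra.
have dled : d <= delta0.
  have h : d ^+ 2 * (1 / delta0 ^+ 2) <= 1.
    by apply: le_trans dM; rewrite ler_wpM2l// sqr_ge0.
  move: h; rewrite mul1r ler_pdivrMr ?exprn_gt0// mul1r.
  by rewrite ler_pXn2r ?nnegrE// ltW.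
pose b := 1 - p0 * d / (4 * expR 1).
have ruinb mu t : 1 - d <= mu <= 1 -> (ruin (P mu) (1 - 2 * d) t 0 <= b%:E)%E.
  exact: ruin0_uniform.
have d01 : 0 < d <= 1 by rewrite d0/=; lra.
have b0 : 0 <= b.
  have [mu mul mur] := exists_good_mean Gamma01 Gammareg c0pos d01.
  rewrite -lee_fin; apply: le_trans (ruinb mu 0%N _); first exact: ruin_ge0.
  by rewrite mul.
have b1 : b <= 1 by rewrite /b gerBl divr_ge0 ?mulr_ge0// ltW.
have bb : 0 <= b <= 1 by rewrite b0.
have gbE := integral_good_factor_le Gammareg d01 bb.
have hbE : (\int[Gamma]_mu (bad_cost d mu)%:E <= _)%E :=
  integral_bad_cost_le Gamma01 Gammareg (introT andP (conj d0 _ : 0 < d /\ d < 1)).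
have mN : (0 < m)%N by rewrite -(ltr0n R).
apply: le_trans (BR_ssgreedy_le Gamma01 T sgP d0 b0 ruinb mN mk gbE (hbE _)) _.
  by lra.
set gb := 1 - c0 * d * (1 - b).
have gb0 : 0 <= gb.
  rewrite -lee_fin; apply: le_trans gbE; apply: integral_ge0 => x _.
  by rewrite lee_fin good_factor_ge0.
(* This equation dictates [d]: good means have mass at least [c0 * d], each survives with
   probability at least [p0 * d / (4 * expR 1)], and the product must be [ln T / m] for
   [T * gb ^ m <= 1]. *)
have gbl : gb = 1 - ln T%:R / m%:R.
  rewrite /gb /b subKr; congr (_ - _).
  have -> : c0 * d * (p0 * d / (4 * expR 1)) = d ^+ 2 * (c0 * p0) / (4 * expR 1).
    by field; rewrite gt_eqF.
  by rewrite dd /d2 /X; field; rewrite !gt_eqF.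
have T0 : 0 < T%:R :> R by rewrite ltr0n (ltn_trans _ T1).
have Tgb : T%:R * gb ^+ m <= 1.
  have h : gb <= expR (- (ln T%:R / m%:R)) by rewrite gbl expR_ge1Dx.
  apply: (@le_trans _ _ (T%:R * expR (- (ln T%:R / m%:R)) ^+ m)).
    by rewrite ler_wpM2l ?ler0n// lerXn2r// nnegrE expR_ge0.
  rewrite -expRM_natr mulNr divfK ?gt_eqF// expRN lnK ?posrE//.
  by rewrite divff ?gt_eqF.
have lnd : ln d = - ((ln (m%:R * c0 * p0 / (4 * expR 1)) - ln (ln T%:R)) / 2).
  have : ln (d ^+ 2) = ln (ln T%:R) - ln (m%:R * c0 * p0 / (4 * expR 1)).
    rewrite -ln_div ?posrE//; last by rewrite divr_gt0// mulr_gt0.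
    by congr ln; rewrite dd /d2 /X; field; rewrite !gt_eqF.
  by rewrite lnXn// mulr2n; lra.
rewrite lee_fin lnd.
set Y := ln (_ / _); set Z := ln (ln _).
have C1pos : 0 < 1 - expR (-1) :> R by rewrite subr_gt0 expR_lt1 oppr_lt0.
have -> : m%:R * (3 / ((1 - expR (-1)) / 2) * (C0 * (5 - - ((Y - Z) / 2)))) =
  3 * C0 * m%:R / (2 * ((1 - expR (-1)) / 2)) * (10 + Y - Z).
  by field; rewrite gt_eqF.
by lra.
Qed.

Lemma BR_ssgreedy_two_thirds (a b : R) : 0 < a -> a <= b ->
  exists C T0 : R, forall T k m : nat,
    T0 <= T%:R ->
    a * T%:R `^ (2 / 3) <= m%:R <= b * T%:R `^ (2 / 3) ->
    (m <= k)%N ->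
    (BR_ssgreedy Gamma P T k m <=
       (C * T%:R `^ (2 / 3) * (ln T%:R) `^ C)%:E)%E.
Proof.
move=> a0 ab.
have e0 : 0 < expR 1 :> R := expR_gt0 1.
have e2 : 2 <= expR 1 :> R by have := expR_ge1Dx (1 : R); lra.
have cp : 0 < c0 * p0 by exact: mulr_gt0.
have b0 : 0 < b by exact: lt_le_trans ab.
pose K := 4 * expR 1 * Num.max 400 (1 / delta0 ^+ 2) / (c0 * p0).
have K0 : 0 < K.
  by rewrite divr_gt0// !mulr_gt0// lt_max ltr0n.
pose M := 4 * expR 1 / (a * (c0 * p0)).
have M0 : 0 < M by rewrite divr_gt0// !mulr_gt0.
pose z := c0 * p0 / (4 * expR 1).
have z0 : 0 < z by rewrite divr_gt0// mulr_gt0.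
have C00 : 0 < C0 by apply: lt_le_trans (regular_ge1 Gamma01 Gammareg).
have C1pos : 0 < 1 - expR (-1) :> R by rewrite subr_gt0 expR_lt1 oppr_lt0.
pose N := 3 * C0 * b / (2 * ((1 - expR (-1)) / 2)).
have N0 : 0 < N by rewrite divr_gt0 ?mulr_gt0// divr_gt0.
(* One summand for each of the three terms of [BR_ssgreedy_bound], each compared with
   [u ^ 2 * l]. *)
pose C := 1 + 3 * (1 + M) + N * (11 + b * z).
have bz0 : 0 < b * z by exact: mulr_gt0.
have C1 : 1 <= C by rewrite /C; have : 0 < N * (11 + b * z) by [rewrite mulr_gt0//; lra]; lra.
(* The first summand ensures [1 <= ln T]. The second gives [3 * K <= a * u], so that
   [m >= a * u ^ 2] exceeds the threshold [K * ln T], as [ln T <= 3 * u]. *)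
exists C, (expR 1 + (3 * K / a) ^+ 3) => T k m TT0 /andP[am mb] mk.
have r0 : 0 < 3 * K / a by rewrite divr_gt0// mulr_gt0.
have Te : expR 1 <= T%:R :> R by have := exprn_gt0 3 r0; lra.
have Tr : (3 * K / a) ^+ 3 <= T%:R by lra.
have T2 : 2 <= T%:R :> R by lra.
have Tpos : 0 < T%:R :> R by lra.
pose u : R := T%:R `^ (1 / 3); pose l : R := ln T%:R.
have u0 : 0 < u by exact: powR_gt0.
have u3 : u ^+ 3 = T%:R.
  by rewrite -powR_mulrn ?ltW// -powRrM (_ : 1 / 3 * 3%:R = 1) ?powRr1 ?ltW//; field.
have u2 : T%:R `^ (2 / 3) = u ^+ 2.
  by rewrite -powR_mulrn ?ltW// -powRrM; congr (_ `^ _); field.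
have ur : 3 * K / a <= u.
  by rewrite -(@ler_pXn2r _ 3) ?u3 ?nnegrE//; exact: ltW.
have l1 : 1 <= l.
  have : ln (expR 1) <= l by rewrite /l ler_ln ?posrE.
  by rewrite expRK.
have lnu : ln u = l / 3 by rewrite /u ln_powR /l mulrC mul1r.
have l3u : l <= 3 * u by have := ln_sublinear u0; rewrite lnu; lra.
have u1 : 1 <= u.
  rewrite leNgt; apply/negP => h; have : ln u < 0 by rewrite ln_lt0// u0.
  by rewrite lnu; lra.
have u20 : 0 < u ^+ 2 by exact: exprn_gt0.
rewrite u2 in am mb *.
have m0 : 0 < m%:R :> R by apply: lt_le_trans am; rewrite mulr_gt0.
have TN : (1 < T)%N by rewrite -(ltr1n R); lra.
apply: le_trans (BR_ssgreedy_bound TN mk _) _.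
  rewrite -/l [leLHS](_ : _ = K * l); last by rewrite /K; field; rewrite !gt_eqF.
  apply: (@le_trans _ _ (K * (3 * u))); first by rewrite ler_wpM2l// ltW.
  apply: le_trans am.
  have : 3 * K <= u * a by rewrite -ler_pdivrMr.
  by nra.
rewrite lee_fin -/l.
apply: (@le_trans _ _ (C * u ^+ 2 * l)); last first.
  apply: ler_wpM2l; last exact: le1r_powR.
  by apply: mulr_ge0; [exact: le_trans C1|exact: ltW].
have t1 : 1 <= u ^+ 2 * l by rewrite -[leLHS]mulr1 ler_pM// exprn_ege1.
have t2 : 3 * T%:R * Num.sqrt (4 * expR 1 * l / (m%:R * c0 * p0)) <=
    3 * (1 + M) * (u ^+ 2 * l).
  (* The root of [M * l] is bounded by [(1 + M) * l], using [1 <= l]. *)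
  have h : Num.sqrt (4 * expR 1 * l / (m%:R * c0 * p0)) <= (1 + M) * l / u.
    have q0 : 0 <= (1 + M) * l / u.
      by apply: divr_ge0; [apply: mulr_ge0; lra|exact: ltW].
    rewrite -[leRHS]ger0_norm// -sqrtr_sqr ler_wsqrtr//.
    apply: (@le_trans _ _ (M * l / u ^+ 2)).
      have -> : M * l / u ^+ 2 = 4 * expR 1 * l / (a * u ^+ 2 * c0 * p0).
        by rewrite /M; field; rewrite !gt_eqF.
      rewrite ler_wpM2l//; first by rewrite !mulr_ge0//; lra.
      rewrite lef_pV2 ?posrE; last 2 first.
      - by rewrite !mulr_gt0.
      - by rewrite !mulr_gt0.
      by rewrite !ler_wpM2r// ltW.
    rewrite [leRHS]exprMn exprVn ler_wpM2r ?invr_ge0 ?sqr_ge0//.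
    have w1 : 1 <= (1 + M) * l by nra.
    have : M * l <= (1 + M) * l by apply: ler_wpM2r; lra.
    by rewrite expr2 => /le_trans; apply; rewrite ler_peMr//; lra.
  have T30 : 0 <= 3 * T%:R :> R by lra.
  apply: le_trans (ler_wpM2l T30 h) _.
  rewrite -u3 le_eqVlt; apply/orP; left; apply/eqP; field.
  by rewrite gt_eqF.
have t3 : 3 * C0 * m%:R / (2 * ((1 - expR (-1)) / 2)) *
    (10 + ln (m%:R * c0 * p0 / (4 * expR 1)) - ln l) <=
    N * (11 + b * z) * (u ^+ 2 * l).
  have -> : m%:R * c0 * p0 / (4 * expR 1) = m%:R * z by rewrite /z !mulrA.
  have lnm : ln (m%:R * z) <= b * z + l.
    have mz : m%:R * z <= (b * z) * (u * u).
      by rewrite mulrAC -expr2; apply: ler_wpM2r; [exact: ltW|].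
    apply: (@le_trans _ _ (ln ((b * z) * (u * u)))).
      by rewrite ler_ln ?posrE ?mulr_gt0.
    have -> : ln (b * z * (u * u)) = ln (b * z) + (ln u + ln u).
      by rewrite [LHS]lnM ?posrE ?mulr_gt0// [X in _ + X]lnM ?posrE.
    rewrite lnu.
    by have := ln_sublinear bz0; lra.
  have lnl : 0 <= ln l by exact: ln_ge0.
  have q : 10 + ln (m%:R * z) - ln l <= (11 + b * z) * l by nra.
  apply: (@le_trans _ _ (3 * C0 * m%:R / (2 * ((1 - expR (-1)) / 2)) *
     ((11 + b * z) * l))).
    by rewrite ler_wpM2l// divr_ge0 ?mulr_ge0 ?ltW// divr_gt0.
  have -> : N * (11 + b * z) * (u ^+ 2 * l) = N / b * (b * u ^+ 2) * ((11 + b * z) * l).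
    by field; rewrite gt_eqF.
  have -> : 3 * C0 * m%:R / (2 * ((1 - expR (-1)) / 2)) = N / b * m%:R.
    by rewrite /N; field; rewrite !gt_eqF.
  apply: ler_wpM2r; first by apply: mulr_ge0; lra.
  by apply: ler_wpM2l => //; rewrite divr_ge0// ltW.
have -> : C * u ^+ 2 * l = u ^+ 2 * l + 3 * (1 + M) * (u ^+ 2 * l) +
  N * (11 + b * z) * (u ^+ 2 * l) by rewrite /C; ring.
by apply: lerD => //; apply: lerD.
Qed.

End regret_bound.

Theorem theorem5 (R : realType) (Gamma : probability (R) R)
    (P : R -> probability (R) R) (c0 C0 p0 delta0 : R) :
  prior_on_unit Gamma -> has_density Gamma ->
  0 < c0 -> c0 < C0 -> one_regular Gamma c0 C0 ->
  family_measurable P ->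
  (forall mu : R, 0 <= mu <= 1 -> has_mean (P mu) mu) ->
  (forall mu : R, 0 <= mu <= 1 -> subgaussian1 (P mu) mu) ->
  0 < p0 -> 0 < delta0 -> uniformly_upward_looking P p0 delta0 ->
  let C1 := (1 - expR (-1)) / 2 in
  (forall T k : nat, (1 < T)%N ->
     4 * expR 1 * ln T%:R * Num.max 400 (1 / delta0 ^+ 2) / (c0 * p0) <= k%:R ->
     (BR_greedy Gamma P T k <=
       (1 + 3 * T%:R * Num.sqrt (4 * expR 1 * ln T%:R / (k%:R * c0 * p0))
        + 3 * C0 * k%:R / (2 * C1) *
          (10 + ln (k%:R * c0 * p0 / (4 * expR 1)) - ln (ln T%:R)))%:E)%E)
  /\
  (forall a b : R, 0 < a -> a <= b ->
     exists C T0 : R, forall T k m : nat,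
       T0 <= T%:R ->
       a * T%:R `^ (2 / 3) <= m%:R <= b * T%:R `^ (2 / 3) ->
       (m <= k)%N ->
       (BR_ssgreedy Gamma P T k m <=
          (C * T%:R `^ (2 / 3) * (ln T%:R) `^ C)%:E)%E).
Proof.
move=> Gamma01 _ c0pos _ Gammareg _ meanP sgP p0pos delta0pos upP; split.
  move=> T k T1 kbig; rewrite BR_greedyE.
  exact: (BR_ssgreedy_bound Gamma01 c0pos Gammareg meanP sgP p0pos delta0pos upP).
exact: (BR_ssgreedy_two_thirds Gamma01 c0pos Gammareg meanP sgP p0pos delta0pos upP).
Qed.
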